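(* Let $n \geq 6$ and $3 \leq d \leq n-2$ be integers. Among all unicyclic graphs of order $n$ with diameter $d$, the graph $C_{3}(P^{n-d-2}_{\lceil \frac{d-1}{2} \rceil}, P_{\lfloor \frac{d-1}{2} \rfloor +1}, S_{1})$ is the unique graph (up to isomorphism) with minimum edge Szeged index.
   Context: All graphs are finite, simple, undirected and connected. A unicyclic graph of order $n$ is a connected graph with $n$ vertices and $n$ edges. The diameter of $G$ is the maximum distance $d(u,v|G)$ over all pairs of vertices. For an edge $f=ab$ and a vertex $w$, the distance is $d(f,w|G)=\min\{d(a,w|G),d(b,w|G)\}$. For an edge $e=uv$, let $m_u(e|G)$ be the number of edges $f\in E(G)$ with $d(f,u|G)<d(f,v|G)$, and $m_v(e|G)$ the number of edges $f$ with $d(f,v|G)<d(f,u|G)$. The edge Szeged index is $Sz_e(G)=\sum_{uv\in E(G)} m_u(uv|G)\,m_v(uv|G)$. The graph $C_{3}(P^{n-d-2}_{\lceil \frac{d-1}{2} \rceil}, P_{\lfloor \frac{d-1}{2} \rfloor +1}, S_{1})$ is defined as follows: take a triangle $v_1v_2v_3v_1$; at $v_1$ attach a pendent path with $\lceil \frac{d-1}{2}\rceil$ edges (i.e. $v_1$ is an end vertex of a path on $\lceil \frac{d-1}{2}\rceil+1$ vertices) together with $n-d-2$ pendent vertices adjacent to $v_1$; at $v_2$ attach a pendent path with $\lfloor \frac{d-1}{2}\rfloor$ edges (i.e. $v_2$ is an end vertex of a path on $\lfloor \frac{d-1}{2}\rfloor+1$ vertices); $v_3$ has no further neighbours. This graph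 has $n$ vertices and diameter $d$. *)

(* Defs.v *)
From mathcomp Require Import all_boot.
Set Implicit Arguments. Unset Strict Implicit. Unset Printing Implicit Defensive.

Section Graphs.
Variable n : nat.
Implicit Types (G : rel 'I_n) (u v w : 'I_n).

Definition simple_graph G := symmetric G /\ irreflexive G.

Definition connected G := forall u v, connect G u v.

Definition walk_len G k u v : bool :=
  [exists p : k.-tuple 'I_n, path G u p && (last u p == v)].

(* distance d(u,v|G): least k with a walk of length k (for connected G this
   is < n, hence found in iota 0 n) *)
Definition dist G u v : nat := find (fun k => walk_len G k u v) (iota 0 n).

Definition edges G : {set 'I_n * 'I_n} :=
  [set p | G p.1 p.2 && (p.1 < p.2)%N].

Definition unicyclic G := connected G /\ #|edges G| = n.

Definition diameter G : nat := \max_(u : 'I_n) \max_(v : 'I_n) dist G u v.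

Definition edist G (f : 'I_n * 'I_n) w : nat := minn (dist G f.1 w) (dist G f.2 w).

Definition m_ G u v : nat := #|[set f in edges G | (edist G f u < edist G f v)%N]|.

Definition Sz_e G : nat := \sum_(f in edges G) m_ G f.1 f.2 * m_ G f.2 f.1.

Definition isomorphic (G H : rel 'I_n) :=
  exists f : 'I_n -> 'I_n, bijective f /\ forall x y, G x y = H (f x) (f y).

End Graphs.

(* The graph C_3(P^{n-d-2}_{ceil((d-1)/2)}, P_{floor((d-1)/2)+1}, S_1):
   v1 = 0, v2 = 1, v3 = 2 (triangle); vertices 3 .. 2+a form the pendent path
   of a = ceil((d-1)/2) edges at v1; vertices 3+a .. 2+a+b the pendent path of
   b = floor((d-1)/2) edges at v2; vertices 3+a+b .. n-1 (n-d-2 of them) are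
   pendent vertices adjacent to v1. *)
Definition cparent (d j : nat) : nat :=
  let a := uphalf (d - 1) in
  let b := (d - 1)./2 in
  if j == 3 then 0
  else if (j < 3 + a)%N then j.-1
  else if j == 3 + a then 1
  else if (j < 3 + a + b)%N then j.-1
  else 0.

Definition cadj (d i j : nat) : bool :=
  [&& (i < 3)%N, (j < 3)%N & i != j] || ((3 <= j)%N && (cparent d j == i)).

Definition C3graph (n d : nat) : rel 'I_n :=
  fun x y => cadj d x y || cadj d y x.
Arguments C3graph : clear implicits.

(* Main.v *)
Require Import Defs.
From mathcomp Require Import all_boot.
From mathcomp Require Import zify.
Set Implicit Arguments. Unset Strict Implicit. Unset Printing Implicit Defensive.

(* View a unicyclic graph with its n edges as a functional graph: the edge {w, f w}
   is counted through w.  A bridge above which s edges hang contributes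
   s (n - 1 - s).  Along a geodesic of d edges, the i-th edge has at least i edges on one
   side and d - 1 - i on the other, so if it is a bridge it contributes at least
   j (n - 1 - j) with j = min (i, d - 1 - i).  If the geodesic uses t edges of a
   k-cycle, the cycle contributes
     k q^2 + 2 q r (n - k) + (sum over cycle edges of WL * WR),
   with q = (k - 1) / 2 and r = k / 2 (rounded down), where WL and WR count the
   non-cycle edges on both sides.  Pairing opposite cycle edges bounds the last sum
   from below by t m (n - k - m) (twice this for even k), where m is the shorter of
   the two parts of the geodesic outside the cycle.  This always exceeds what the t
   cycle edges would contribute as bridges by at least 2 n - 3 - 2 b, where
   b = (d - 1) / 2, strictly if k > 3 or t = 0.  Equality forces a triangle crossed
   in the middle of the geodesic, no branching along the path, and all the other
   vertices pendent at the same triangle vertex. *)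

(** * Distances *)

Section Distance.
Variables (n : nat) (G : rel 'I_n).
Implicit Types u v w : 'I_n.

Lemma walk_lenP k u v :
  reflect (exists p, [/\ path G u p, last u p = v & size p = k])
          (walk_len G k u v).
Proof.
apply: (iffP existsP) => [[p /andP[Gp /eqP lp]]|[p [Gp lp sp]]].
  by exists p; rewrite size_tuple.
by move/eqP: sp => sp; exists (Tuple sp); rewrite Gp lp eqxx.
Qed.

Lemma dist_le_walk k u v : walk_len G k u v -> dist G u v <= k.
Proof.
move=> wk; rewrite leqNgt; apply/negP => lt_k.
have := before_find 0 lt_k; rewrite nth_iota ?wk //.
by apply: leq_trans lt_k _; rewrite -[X in _ <= X](size_iota 0) find_size.
Qed.

Lemma distxx u : dist G u u = 0.
Proof.
by apply/eqP; rewrite -leqn0; apply: dist_le_walk; apply/walk_lenP; exists [::].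
Qed.

Hypotheses (Gsym : symmetric G) (Gconn : connected G).

Lemma dist_walk u v : walk_len G (dist G u v) u v.
Proof.
have [p Gp lp] := connectP (Gconn u v).
case/shortenP: Gp lp => p' Gp' Up' _ lp'.
have szp : size p' < n.
  by have := max_card [in u :: p']; rewrite (card_uniqP Up') card_ord.
have hs : has (fun k => walk_len G k u v) (iota 0 n).
  apply/hasP; exists (size p'); first by rewrite mem_iota.
  by apply/walk_lenP; exists p'.
have := nth_find 0 hs; rewrite nth_iota //.
by rewrite -[X in _ < X](size_iota 0) -has_find.
Qed.

Lemma dist_triangle w u v : dist G u v <= dist G u w + dist G w v.
Proof.
have /walk_lenP[p [Gp lp sp]] := dist_walk u w.
have /walk_lenP[q [Gq lq sq]] := dist_walk w v.
apply: dist_le_walk; apply/walk_lenP; exists (p ++ q).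
by rewrite cat_path last_cat size_cat lp Gp Gq lq sp sq.
Qed.

Lemma dist_sym u v : dist G u v = dist G v u.
Proof.
suff le u' v' : dist G u' v' <= dist G v' u' by apply/eqP; rewrite eqn_leq !le.
have /walk_lenP[p [Gp lp sp]] := dist_walk v' u'.
apply: dist_le_walk; apply/walk_lenP; exists (rev (belast v' p)).
rewrite size_rev size_belast sp -lp rev_path; split=> //.
  by rewrite (eq_path (e' := G)) // => a b; rewrite Gsym.
by case: p {Gp sp lp} => //= a p; rewrite rev_cons last_rcons.
Qed.

Lemma dist_edge u v : G u v -> dist G u v <= 1.
Proof.
by move=> Guv; apply: dist_le_walk; apply/walk_lenP; exists [:: v]; rewrite /= Guv.
Qed.

Lemma dist_step u v : 0 < dist G u v -> exists2 w, G u w & (dist G w v).+1 = dist G u v.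
Proof.
have /walk_lenP[[|w p] [/= Gp lp sp]] := dist_walk u v; first by rewrite -sp.
move: Gp => /andP[Guw Gp] _; exists w => //; apply/eqP; rewrite eqn_leq.
rewrite -{1}sp ltnS; apply/andP; split.
  by apply: dist_le_walk; apply/walk_lenP; exists p.
by have := dist_triangle w u v; have := dist_edge Guw; lia.
Qed.

Lemma dist_eq0 u v : (dist G u v == 0) = (u == v).
Proof.
apply/eqP/eqP => [d0|->]; last exact: distxx.
by have /walk_lenP[[|w p] [/= _ lp sp]] := dist_walk u v; rewrite ?lp // d0 in sp *.
Qed.

Lemma dist_ge (phi : 'I_n -> nat) v :
  phi v = 0 -> (forall u w, G u w -> phi u <= (phi w).+1) ->
  forall u, phi u <= dist G u v.
Proof.
move=> phiv lip u; have [k dk] : exists k, dist G u v = k by eexists.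
elim: k u dk => [|k IH] u dk.
  by move/eqP: (dk); rewrite dist_eq0 => /eqP->; rewrite phiv.
have /dist_step[w Guw dw] : 0 < dist G u v by rewrite dk.
rewrite -dw; apply: leq_trans (lip _ _ Guw) _; rewrite ltnS.
by apply: IH; lia.
Qed.

(** A function that vanishes at [v] and drops by at most one per edge is a lower bound for the
    distance; a neighbour where it drops by exactly one yields a walk of that length. *)
Lemma dist_potential (phi : 'I_n -> nat) v :
  phi v = 0 -> (forall u w, G u w -> phi u <= (phi w).+1) ->
  (forall u, u != v -> exists2 w, G u w & phi u = (phi w).+1) ->
  forall u, dist G u v = phi u.
Proof.
move=> phiv lip desc u; apply/eqP; rewrite eqn_leq dist_ge // andbT.
have [k pk] : exists k, phi u = k by eexists.
elim: k u pk => [|k IH] u pk; have [->|/desc[w Guw pw]] := eqVneq u v;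
  rewrite ?distxx //; first by rewrite pk in pw.
have := IH w; have := dist_triangle w u v; have := dist_edge Guw; lia.
Qed.

(** The edge from [a] to [b] is the only one leaving [S]: the first step of a geodesic either stays
    in [S], where induction applies, or is that edge. *)
Lemma dist_cut (S : {set 'I_n}) a b :
  G a b -> (forall u w, G u w -> u \in S -> w \notin S -> u = a /\ w = b) ->
  forall u v, u \in S -> v \notin S -> dist G u v = (dist G u a + dist G b v).+1.
Proof.
move=> Gab cut u v uS vS; apply/eqP; rewrite eqn_leq; apply/andP; split.
  have := dist_triangle a u v; have := dist_triangle b a v; have := dist_edge Gab.
  lia.
have [k dk] : exists k, dist G u v = k by eexists.
elim: k u uS dk => [|k IH] u uS dk.
  by move/eqP: dk; rewrite dist_eq0 => /eqP uv; rewrite uv (negPf vS) in uS.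
have /dist_step[w Guw dw] : 0 < dist G u v by rewrite dk.
have [wS|wS] := boolP (w \in S).
  have dw' : dist G w v = k by lia.
  have := IH w wS dw'; have := dist_triangle w u a; have := dist_edge Guw; lia.
by have [<- <-] := cut _ _ Guw uS wS; rewrite distxx; lia.
Qed.

End Distance.

(** * Positions on a cycle *)

(* The number of forward steps from [a] to [b] on the oriented [k]-cycle. *)
Definition fwd k a b := if a <= b then b - a else k + b - a.

Definition cnext k i := if i.+1 == k then 0 else i.+1.

Lemma cnext_lt k i : i < k -> cnext k i < k.
Proof. by rewrite /cnext; case: ifP => ?; lia. Qed.

Lemma fwd_lt k a b : a < k -> b < k -> fwd k a b < k.
Proof. by rewrite /fwd; case: ifP => ?; lia. Qed.

Lemma fwdC k a b : a < k -> b < k ->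
  fwd k b a = if fwd k a b == 0 then 0 else k - fwd k a b.
Proof. by rewrite /fwd; case: (ltngtP a b) => ? ? ?; case: ifP; lia. Qed.

Lemma fwd_cnextr k a b : a < k -> b < k -> fwd k a (cnext k b) = cnext k (fwd k a b).
Proof.
rewrite /fwd /cnext; case: (eqVneq b.+1 k) => ? ? ?; rewrite ?leqn0;
by case: (leqP a b) => ?; repeat case: ifP => ?; lia.
Qed.

Lemma fwd_cnextl k a b : a < k -> b < k ->
  fwd k (cnext k a) b = if fwd k a b == 0 then k.-1 else (fwd k a b).-1.
Proof.
rewrite /fwd /cnext; case: (eqVneq a.+1 k) => ? ? ?; rewrite ?leq0n;
by case: (leqP a b) => ?; repeat case: ifP => ?; lia.
Qed.

Definition cdist k a b := minn (fwd k a b) (fwd k b a).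

Lemma cdistE k a b : a < k -> b < k -> cdist k a b = minn (fwd k a b) (k - fwd k a b).
Proof.
by move=> ak bk; have := fwd_lt ak bk; rewrite /cdist (fwdC ak bk); case: ifP; lia.
Qed.

Lemma cdist_cnextr k a b : a < k -> b < k ->
  cdist k a (cnext k b) = minn (fwd k a b).+1 (k - (fwd k a b).+1).
Proof.
move=> ak bk; rewrite cdistE ?cnext_lt // fwd_cnextr //; have := fwd_lt ak bk.
by rewrite /cnext; case: ifP; lia.
Qed.

Lemma cdist_cnextl k a b : a < k -> b < k ->
  cdist k (cnext k a) b = if fwd k a b == 0 then minn k.-1 1
                          else minn (fwd k a b).-1 (k - (fwd k a b).-1).
Proof.
move=> ak bk; rewrite cdistE ?cnext_lt // fwd_cnextl //; have := fwd_lt ak bk.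
by case: ifP; lia.
Qed.

Lemma cdist_cnext2 k a b : a < k -> b < k ->
  cdist k (cnext k a) (cnext k b) = cdist k a b.
Proof.
move=> ak bk; rewrite !cdistE ?cnext_lt // fwd_cnextl ?cnext_lt // fwd_cnextr //.
have := fwd_lt ak bk; rewrite /cnext; set x := fwd k a b.
by case: (eqVneq x.+1 k) => ? ? /=; lia.
Qed.

Section Nearer.
Variables (k a i : nat).
Hypotheses (k2 : 2 < k) (ak : a < k) (ik : i < k).

(** A non-cycle edge is compared with the ends of cycle edge [i] through its cycle position [a]
    alone. At forward distance [x] the first end is nearer exactly when [2 x + 1 < k]. *)
Lemma cdist_lt_cnext : (cdist k a i < cdist k a (cnext k i)) = (fwd k a i < k./2).
Proof. by rewrite cdist_cnextr // cdistE //; have := fwd_lt ak ik; lia. Qed.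

Lemma cdist_gt_cnext : (cdist k a (cnext k i) < cdist k a i) = (0 < fwd k i a <= k./2).
Proof.
rewrite cdist_cnextr // cdistE // (fwdC ak ik); have := fwd_lt ak ik.
by case: ifP; lia.
Qed.

(** Here the compared edge is the cycle edge starting at [a]. The case [a = i] drops out, as an edge
    is equally far from its own ends. *)
Lemma cdist_edge_lt : (minn (cdist k a i) (cdist k (cnext k a) i) <
    minn (cdist k a (cnext k i)) (cdist k (cnext k a) (cnext k i)))
  = (0 < fwd k a i <= k.-1./2).
Proof.
rewrite cdist_cnext2 // cdist_cnextr // cdist_cnextl // cdistE //.
by have := fwd_lt ak ik; case: ifP; lia.
Qed.

Lemma cdist_edge_gt : (minn (cdist k a (cnext k i)) (cdist k (cnext k a) (cnext k i)) <
    minn (cdist k a i) (cdist k (cnext k a) i))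
  = (0 < fwd k i a <= k.-1./2).
Proof.
rewrite cdist_cnext2 // cdist_cnextr // cdist_cnextl // cdistE // (fwdC ak ik).
by have := fwd_lt ak ik; case: ifP; lia.
Qed.

End Nearer.

Lemma sum_fwdl k (F : nat -> nat) i : i < k ->
  \sum_(y < k) F (fwd k y i) = \sum_(y < k) F y.
Proof.
move=> ik; have lt (y : 'I_k) : fwd k y i < k.
  by have yk := ltn_ord y; rewrite /fwd; case: ifP => ?; lia.
rewrite [RHS](reindex_inj (h := fun y => Ordinal (lt y))) // => a b [].
have := ltn_ord a; have := ltn_ord b; rewrite /fwd => ak bk ab; apply: val_inj => /=.
by move: ab; rewrite ?leq0n; repeat case: ifP => ?; lia.
Qed.

Lemma sum_fwdr k (F : nat -> nat) i : i < k ->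
  \sum_(y < k) F (fwd k i y) = \sum_(y < k) F y.
Proof.
move=> ik; have lt (y : 'I_k) : fwd k i y < k.
  by have yk := ltn_ord y; rewrite /fwd; case: ifP => ?; lia.
rewrite [RHS](reindex_inj (h := fun y => Ordinal (lt y))) // => a b [].
have := ltn_ord a; have := ltn_ord b; rewrite /fwd => ak bk ab; apply: val_inj => /=.
by move: ab; rewrite ?leq0n; repeat case: ifP => ?; lia.
Qed.

Lemma sum_lt k r : r <= k -> \sum_(y < k) (y < r) = r.
Proof.
move=> rk; suff -> : \sum_(y < k) (y < r) = minn k r by lia.
elim: k {rk} => [|k IH]; first by rewrite big_ord0 min0n.
by rewrite big_ord_recr /= IH; lia.
Qed.

Lemma sum_pos_le k r : r < k -> \sum_(y < k) (0 < y <= r) = r.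
Proof.
move=> rk; case: k rk => // k rk; rewrite big_ord_recl /= add0n.
by rewrite -[RHS](@sum_lt k) //; apply: eq_bigr.
Qed.

(** * Unicyclic graphs as functional graphs *)

(** [edges] stores each edge with its smaller end first; this puts an unordered pair into that
    form. *)
Definition mk_edge n (u v : 'I_n) := if u < v then (u, v) else (v, u).

(* A unicyclic graph has as many edges as vertices, so it can be seen as a
   functional graph whose edges are the pairs [u, f u].  The vertices of height
   [h u = 0] form the cycle [c 0, ..., c (k - 1)], oriented by [f]; the others
   hang at height [h u] above the cycle vertex of index [p u]. *)
Record unicyclic_map n (G : rel 'I_n) k (f : 'I_n -> 'I_n) (h p : 'I_n -> nat)
    (c : nat -> 'I_n) : Prop := UnicyclicMap {
  um_adj : forall u v, G u v = (f u == v) || (f v == u);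
  um_k : 2 < k;
  um_p : forall u, p u < k;
  um_tree : forall u, 0 < h u -> (h (f u)).+1 = h u /\ p (f u) = p u;
  um_cyc : forall u, h u = 0 ->
    h (f u) = 0 /\ p (f u) = cnext k (p u);
  um_c : forall i, i < k -> h (c i) = 0 /\ p (c i) = i;
  um_pK : forall u, h u = 0 -> c (p u) = u }.

Section Edges.
Variable n : nat.
Implicit Types (G : rel 'I_n) (u v w : 'I_n).

Lemma mk_edgeC u v : mk_edge u v = mk_edge v u.
Proof.
rewrite /mk_edge; case: (ltngtP u v) => // uv.
by have -> : u = v by apply: val_inj.
Qed.

Lemma mk_edgeP u v a b :
  mk_edge u v = mk_edge a b -> u = a /\ v = b \/ u = b /\ v = a.
Proof.
by rewrite /mk_edge; case: (u < v); case: (a < b) => -[-> ->]; auto.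
Qed.

Lemma mem_edges G u v :
  simple_graph G -> (mk_edge u v \in edges G) = G u v.
Proof.
move=> [Gs Gi]; rewrite inE /mk_edge; case: (ltngtP u v) => uv /=.
- by rewrite uv andbT.
- by rewrite uv andbT Gs.
have -> : u = v by apply: val_inj.
by rewrite /= ltnn andbF Gi.
Qed.

Lemma edges_mk G e : e \in edges G -> exists u v, [/\ e = mk_edge u v, G u v & u < v].
Proof.
by case: e => u v; rewrite inE /= => /andP[Guv uv]; exists u, v; rewrite /mk_edge uv.
Qed.

Lemma bfs_parent G r : symmetric G -> connected G ->
  exists par : 'I_n -> 'I_n, forall u, u != r ->
    G u (par u) /\ (dist G (par u) r).+1 = dist G u r.
Proof.
move=> Gs Gc.
exists (fun u => odflt u [pick w | G u w && ((dist G w r).+1 == dist G u r)]) => u ur.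
case: pickP => [w /andP[? /eqP] //|no].
have /(dist_step Gc)[w Guw dw] : 0 < dist G u r by rewrite lt0n dist_eq0.
by have := no w; rewrite Guw dw eqxx.
Qed.

(** Two vertices with the same parent edge would be parents of each other, each strictly nearer to
    [r] than the other. *)
Lemma card_parent_edges G r (par : 'I_n -> 'I_n) :
  (forall u, u != r -> G u (par u) /\ (dist G (par u) r).+1 = dist G u r) ->
  #|[set mk_edge u (par u) | u in [set~ r]]| = n.-1.
Proof.
move=> parP; rewrite card_in_imset => [|u w]; first by rewrite cardsC1 card_ord.
rewrite !inE => /parP[_ du] /parP[_ dw] /mk_edgeP[[]//|[uw wu]].
by rewrite wu in du; rewrite -uw in dw; lia.
Qed.

Lemma sub_parent_edges G r (par : 'I_n -> 'I_n) : simple_graph G ->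
  (forall u, u != r -> G u (par u) /\ (dist G (par u) r).+1 = dist G u r) ->
  [set mk_edge u (par u) | u in [set~ r]] \subset edges G.
Proof.
move=> sG parP; apply/subsetP => e /imsetP[u]; rewrite !inE => /parP[Gu _] ->.
by have := mem_edges u (par u) sG; rewrite inE Gu.
Qed.

(** A breadth-first tree uses only [n.-1] of the [n] edges. A remaining edge can be deleted, since
    every vertex still reaches [r] through its parents. *)
Lemma unicyclic_delete G (r : 'I_n) : simple_graph G -> unicyclic G ->
  exists x y, [/\ G x y, x != y, 
     connected (fun u v => G u v && (mk_edge u v != mk_edge x y))
   & #|edges (fun u v => G u v && (mk_edge u v != mk_edge x y))| = n.-1].
Proof.
move=> sG [Gc Gn]; have [Gs Gi] := sG.
have n0 : 0 < n := leq_ltn_trans (leq0n r) (ltn_ord r).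
have [par parP] := bfs_parent r Gs Gc.
have cE := card_parent_edges parP; have sE := sub_parent_edges sG parP.
have [e eG eE] : exists2 e, e \in edges G &
    e \notin [set mk_edge u (par u) | u in [set~ r]].
  by apply/subsetPn; apply/negP => /subset_leq_card; rewrite cE Gn; lia.
have [x [y [exy Gxy xy]]] := edges_mk eG; exists x, y.
have xNy : x != y by apply: contraTneq xy => ->; rewrite ltnn.
set T := fun u v => _; have Ts : symmetric T by move=> u v; rewrite /T Gs mk_edgeC.
split=> //.
  have toR u : connect T u r.
    have [k dk] : exists k, dist G u r = k by eexists.
    elim: k u dk => [|k IH] u dk; have [->//|ur] := eqVneq u r.
      by move/eqP: dk; rewrite dist_eq0 // (negPf ur).
    have [Gu du] := parP u ur; apply: (@connect_trans _ _ (par u)).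
      apply: connect1; rewrite /T Gu; apply: contra eE; rewrite exy => /eqP <-.
      by apply: imset_f; rewrite !inE.
    by apply: IH; lia.
  by move=> u v; apply: connect_trans (toR u) _; rewrite (sym_connect_sym Ts).
have -> : edges T = edges G :\ e.
  apply/setP=> -[u v]; rewrite !inE /T exy /=.
  case: (ltnP u v) => uv; last by rewrite !andbF.
  by rewrite !andbT andbC {1}/mk_edge uv.
by rewrite (cardsD1 e) eG in Gn; lia.
Qed.

(* Delete an edge [xy] outside a spanning tree, orient the remaining tree
   towards [x] and close the cycle with [f x = y]. *)
Lemma unicyclic_mapP G : simple_graph G -> unicyclic G -> 0 < n ->
  exists k f h p c, @unicyclic_map n G k f h p c.
Proof.
move=> sG uG n0; have [Gs Gi] := sG.
have [x [y [Gxy xy]]] := unicyclic_delete (Ordinal n0) sG uG.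
set T := fun u v => _ => Tc Tn.
have Ts : symmetric T by move=> u v; rewrite /T Gs mk_edgeC.
have sT : simple_graph T by split=> // u; rewrite /T Gi.
have [par parP] := bfs_parent x Ts Tc.
have cE := card_parent_edges parP; have sE := sub_parent_edges sT parP.
(* [T] has only [n.-1] edges, so its breadth-first tree contains all of them. *)
have /eqP eE : [set mk_edge u (par u) | u in [set~ x]] == edges T.
  by rewrite eqEcard sE /= cE Tn leqnn.
pose D u := dist T u x; pose f u := if u == x then y else par u.
have fP u : u != x -> T u (f u) /\ (D (f u)).+1 = D u.
  by rewrite /f => ux; rewrite (negPf ux); apply: parP.
have D0 u : (D u == 0) = (u == x) by rewrite dist_eq0.
have Dit i : i <= D y -> D (iter i f y) = D y - i.
  elim: i => [|i IH] lei; first by rewrite subn0.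
  have Di := IH (ltnW lei).
  have [|_] := fP (iter i f y); first by rewrite -D0; lia.
  by rewrite iterS; lia.
(* [C u] says that [u] lies on the tree path from [y] down to [x]; the edge [x y] closes this path
   to the cycle. *)
pose C u := (D u <= D y) && (iter (D y - D u) f y == u).
have Cx : C x.
  have Dx : D x = 0 by apply/eqP; rewrite D0.
  by rewrite /C Dx /= subn0 -D0 Dit // subnn.
have exC u : exists m, C (iter m f u).
  exists (D u); have [k dk] : exists k, D u = k by eexists.
  elim: k u dk => [|k IH] u dk; rewrite dk.
    by move/eqP: dk; rewrite D0 => /eqP->.
  have [|_ Du] := fP u; first by rewrite -D0 dk.
  have Dfu : D (f u) = k by lia.
  by rewrite iterSr -{1}Dfu; apply: IH.
pose h u := ex_minn (exC u).
have hC u : C (iter (h u) f u) by rewrite /h; case: ex_minnP.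
have hmin u m : C (iter m f u) -> h u <= m.
  by rewrite /h; case: ex_minnP => ? _ H /H.
have h0 u : h u = 0 <-> C u.
  split=> [h0|Cu]; first by have := hC u; rewrite h0.
  by apply/eqP; rewrite -leqn0; apply: hmin.
pose p u := D y - D (iter (h u) f u).
have Cit i : i <= D y -> C (iter i f y).
  by move=> iy; rewrite /C Dit // subKn // eqxx andbT leq_subr.
exists (D y).+1, f, h, p, (fun i => iter i f y); split.
- move=> u v; apply/idP/orP.
    move=> Guv; have [/eqP/mk_edgeP|ne] := boolP (mk_edge u v == mk_edge x y).
      by rewrite /f; case=> -[-> ->]; rewrite eqxx; auto.
    have : mk_edge u v \in edges T by rewrite mem_edges // /T Guv.
    rewrite -eE => /imsetP[w]; rewrite !inE => wx /mk_edgeP[] [-> ->];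
    by rewrite /f (negPf wx) eqxx; auto.
  have key a b : f a == b -> G a b.
    have [->|ax] := eqVneq a x; first by rewrite {1}/f eqxx => /eqP<-.
    by move/eqP=> <-; have [/andP[]] := fP a ax.
  by case=> /key //; rewrite Gs.
(* [y] differs from [x] and is not adjacent to it in [T], where the edge [x y] is deleted; so the
   cycle has at least three vertices. *)
- have y0 : 0 < D y by rewrite lt0n D0 eq_sym.
  rewrite ltnS ltn_neqAle y0 andbT; apply/negP => /eqP y1.
  have [w Tyw dw] := dist_step Tc y0.
  have /eqP wx : w == x by rewrite -D0 /D; move: dw; rewrite -/(D y) -y1; lia.
  by move: Tyw; rewrite wx /T mk_edgeC eqxx andbF.
- by move=> u; rewrite ltnS leq_subr.
- move=> u hu; have hf : (h (f u)).+1 = h u.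
    apply/eqP; rewrite eqn_leq; apply/andP; split.
      rewrite -[h u in X in _ <= X](ltn_predK hu) ltnS; apply: hmin.
      by rewrite -iterSr (ltn_predK hu); apply: hC.
    by apply: hmin; rewrite iterSr; apply: hC.
  by split=> //; rewrite /p -hf iterSr.
- move=> u hu; have /andP[Du /eqP uE] := (h0 u).1 hu.
  have hfp i : i <= D y -> h (iter i f y) = 0 /\ p (iter i f y) = i.
    move=> iy; have hi : h (iter i f y) = 0 by apply/h0/Cit.
    by split=> //; rewrite /p hi /= Dit // subKn.
  have pu : p u = D y - D u by rewrite /p hu.
  have [ux|ux] := eqVneq u x.
    have Dx : D u = 0 by apply/eqP; rewrite D0 ux.
    have -> : f u = iter 0 f y by rewrite /f ux eqxx.
    by rewrite pu Dx subn0 /cnext eqxx; apply: hfp.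
  have Du0 : 0 < D u by rewrite lt0n D0.
  rewrite -{1 2}uE -iterS pu; have [|-> ->] := hfp (D y - D u).+1; first by lia.
  by split=> //; rewrite /cnext; case: ifP; lia.
- move=> i; rewrite ltnS => iy; have hi : h (iter i f y) = 0 by apply/h0/Cit.
  by split=> //; rewrite /p hi /= Dit // subKn.
move=> u hu; have /andP[Du /eqP uE] := (h0 u).1 hu.
by rewrite /p hu.
Qed.

End Edges.

(** * Distances, subtrees and edge counts in a unicyclic map *)

Section Structure.
Variables (n k : nat) (G : rel 'I_n) (f : 'I_n -> 'I_n).
Variables (h p : 'I_n -> nat) (c : nat -> 'I_n).
Hypothesis M : unicyclic_map G k f h p c.
Implicit Types u v w : 'I_n.

Local Notation q := (k.-1./2).
Local Notation r := (k./2).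

Lemma um_h_iter m u : h (iter m f u) = h u - m.
Proof.
elim: m => [|m IH]; first by rewrite subn0.
rewrite iterS; have [h0|hp] := posnP (h (iter m f u)).
  by have [-> _] := um_cyc M h0; lia.
by have [] := um_tree M hp; lia.
Qed.

Lemma um_p_iter m u : m <= h u -> p (iter m f u) = p u.
Proof.
elim: m => // m IH mh; rewrite iterS.
have [|_ ->] := um_tree M (u := iter m f u); first by rewrite um_h_iter; lia.
by rewrite IH // ltnW.
Qed.

Lemma um_f_cyc i : i < k -> f (c i) = c (cnext k i).
Proof.
move=> ik; have [hi pi] := um_c M ik; have [hf pf] := um_cyc M hi.
by rewrite -[LHS](um_pK M hf) pf pi.
Qed.

Lemma um_root u : iter (h u) f u = c (p u).
Proof.
have h0 : h (iter (h u) f u) = 0 by rewrite um_h_iter subnn.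
by rewrite -(um_pK M h0) um_p_iter.
Qed.

Lemma um_adjf u : G u (f u).
Proof. by rewrite (um_adj M) eqxx. Qed.

Lemma um_f_neq u : f u != u.
Proof.
have k2 := um_k M.
have [h0|hp] := posnP (h u).
  have [_ pf] := um_cyc M h0; apply: contra_not_neq (_ : p (f u) <> p u) => [->//|].
  by rewrite pf /cnext; case: ifP; lia.
by have [hf _] := um_tree M hp; apply: contraTneq hp => fu; rewrite fu in hf; lia.
Qed.

(** Without 2-cycles of [f], the map from [w] to the edge [{w, f w}] is injective. *)
Lemma um_ff_neq u : f (f u) != u.
Proof.
have k2 := um_k M; have [h0|hp] := posnP (h u).
  have [hf pf] := um_cyc M h0; have [_ pff] := um_cyc M hf.
  apply: contra_not_neq (_ : p (f (f u)) <> p u) => [->//|].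
  by rewrite pff pf /cnext; case: (eqVneq (p u).+1 k) => ?; case: ifP => ?; lia.
apply: contraTneq hp => fu; have := um_h_iter 2 u; rewrite /= fu; lia.
Qed.

Lemma um_simple : simple_graph G.
Proof.
split=> [u v|u]; first by rewrite !(um_adj M) orbC.
by rewrite (um_adj M) orbb (negPf (um_f_neq u)).
Qed.

Lemma um_connected : connected G.
Proof.
have Gs := (um_simple).1; have k2 := um_k M.
have fwdc m u : connect G u (iter m f u).
  elim: m => // m IH; apply: connect_trans IH _; exact/connect1/um_adjf.
have to0 u : connect G u (c 0).
  apply: connect_trans (fwdc (h u) u) _; rewrite um_root.
  have [m mE] : exists m, k - p u = m by eexists.
  have := um_p M u; move: (p u) mE => i; elim: m i => [|m IH] i mE ik; first by lia.
  apply: connect_trans (connect1 (um_adjf _)) _; rewrite um_f_cyc //.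
  by rewrite /cnext; case: eqP => // ?; apply: IH; lia.
by move=> u v; apply: connect_trans (to0 u) _; rewrite (sym_connect_sym Gs).
Qed.

(** The right-hand side is a potential for [dist_potential]. It drops along [f] off the cycle, and
    on the cycle along [f] or towards the predecessor, whichever way round is shorter. *)
Lemma um_dist_cyc u i : i < k -> dist G u (c i) = h u + cdist k (p u) i.
Proof.
move=> ik; have [hi pi] := um_c M ik; have k2 := um_k M.
apply: (dist_potential um_connected (phi := fun u => h u + cdist k (p u) i)).
- by rewrite hi pi cdistE // /fwd leqnn; lia.
- move=> v w; rewrite (um_adj M).
  suff key a b : f a = b -> h a + cdist k (p a) i <= (h b + cdist k (p b) i).+1
                         /\ h b + cdist k (p b) i <= (h a + cdist k (p a) i).+1.
    by case/orP => /eqP /key [].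
  move=> <-; have pa := um_p M a; have [ha|ha] := posnP (h a).
    have [-> ->] := um_cyc M ha; rewrite ha cdist_cnextl // cdistE //.
    by have := fwd_lt pa ik; case: ifP; lia.
  by have [ha' ->] := um_tree M ha; lia.
move=> v vi; have pv := um_p M v; have [hv|hv] := posnP (h v); last first.
  have [hv' pv'] := um_tree M hv; exists (f v); first exact: um_adjf.
  by rewrite pv'; lia.
have pvi : p v != i by apply: contra_neq vi => <-; rewrite (um_pK M hv).
have x0 : fwd k (p v) i != 0 by move: pvi; rewrite /fwd; case: ifP; lia.
have [le|lt] := leqP (fwd k (p v) i) (k - fwd k (p v) i).
  exists (f v); first exact: um_adjf.
  have [-> ->] := um_cyc M hv; rewrite hv cdist_cnextl // cdistE // (negPf x0); lia.
pose j := if p v == 0 then k.-1 else (p v).-1.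
have jk : j < k by rewrite /j; case: ifP; lia.
have jv : cnext k j = p v.
  by rewrite /j /cnext; case: (eqVneq (p v) 0) => ?; case: ifP; lia.
have [hj pj] := um_c M jk; exists (c j).
  by rewrite (um_adj M) um_f_cyc // jv (um_pK M hv) eqxx orbT.
move: lt x0; rewrite hj pj hv cdistE // -jv fwd_cnextl // cdistE //.
by have := fwd_lt jk ik; case: ifP; lia.
Qed.

Lemma um_sum_edges (F : 'I_n * 'I_n -> nat) :
  \sum_(e in edges G) F e = \sum_w F (mk_edge w (f w)).
Proof.
have inj : {in predT &, injective (fun w => mk_edge w (f w))}.
  move=> u v _ _ /mk_edgeP[[]//|[-> fu]].
  by have := um_ff_neq v; rewrite fu eqxx.
rewrite -(big_imset _ inj); apply: eq_bigl => e.
apply/idP/imsetP => [eG|[u _ ->]]; last first.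
  by rewrite mem_edges ?um_adjf //; apply: um_simple.
have [u [v [-> Guv _]]] := edges_mk eG.
move: Guv; rewrite (um_adj M) => /orP[]/eqP <-; first by exists u.
by exists v => //; rewrite mk_edgeC.
Qed.

Lemma um_card_edges : #|edges G| = n.
Proof. by rewrite -sum1_card um_sum_edges sum1_card card_ord. Qed.

Lemma edist_mk_edge u v w : edist G (mk_edge u v) w = minn (dist G u w) (dist G v w).
Proof. by rewrite /edist /mk_edge; case: ifP => //; rewrite minnC. Qed.

Lemma um_m_E u v :
  m_ G u v = \sum_w (minn (dist G w u) (dist G (f w) u) <
                     minn (dist G w v) (dist G (f w) v)).
Proof.
rewrite /m_ -sum1_card; under eq_bigl do rewrite inE.
rewrite big_mkcondr /=.
rewrite (um_sum_edges (fun e => if edist G e u < edist G e v then 1 else 0)).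
by apply: eq_bigr => w _; rewrite !edist_mk_edge; case: ifP.
Qed.

Lemma um_Sz : Sz_e G = \sum_w m_ G w (f w) * m_ G (f w) w.
Proof.
rewrite /Sz_e (um_sum_edges (fun e => m_ G e.1 e.2 * m_ G e.2 e.1)).
by apply: eq_bigr => w _; rewrite /mk_edge; case: ifP => //= _; rewrite mulnC.
Qed.

(** The vertices whose path along [f] down to the cycle passes through [v]. For [0 < h v] this is
    the side of the bridge [{v, f v}] away from the cycle. *)
Definition subtree v := [set w | (h v <= h w) && (iter (h w - h v) f w == v)].

Lemma subtree_self v : v \in subtree v.
Proof. by rewrite inE leqnn subnn /=. Qed.

Lemma subtree_f v w : 0 < h v -> w != v -> (f w \in subtree v) = (w \in subtree v).
Proof.
move=> hv wv; rewrite !inE; have [hw|hw] := posnP (h w).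
  have [-> _] := um_cyc M hw; rewrite hw; lia.
have [hf _] := um_tree M hw; rewrite -hf.
have [lt|lt] := leqP (h v) (h (f w)).
  by rewrite subSn // iterSr leqW.
have [le|//] := leqP (h v) (h (f w)).+1.
have -> : h v = h w by lia.
by rewrite -hf subnn /= (negPf wv).
Qed.

Lemma subtree_fself v : 0 < h v -> f v \notin subtree v.
Proof. by move=> hv; rewrite inE; have [<- _] := um_tree M hv; rewrite ltnn. Qed.

Lemma subtree_cut v u w : 0 < h v -> G u w -> u \in subtree v -> w \notin subtree v ->
  u = v /\ w = f v.
Proof.
move=> hv; rewrite (um_adj M) => /orP[]/eqP <- uS wS.
  by have [->//|uv] := eqVneq u v; rewrite subtree_f // uS in wS.
have [wv|wv] := eqVneq w v; first by rewrite wv subtree_self in wS.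
by rewrite -(subtree_f hv wv) uS in wS.
Qed.

(** A vertex is one step nearer to the end of the bridge on its own side. The edge [{w, f w}]
    belongs to the side of [w], except that [w = v] gives the bridge itself, which counts for
    neither. *)
Lemma um_m_tree v : 0 < h v ->
  m_ G v (f v) = #|subtree v|.-1 /\ m_ G (f v) v = n - #|subtree v|.
Proof.
move=> hv; have Gs := um_simple.1; have Gc := um_connected.
have vfv := um_adjf v; have fvN := subtree_fself hv; have vS := subtree_self v.
have din w : w \in subtree v -> dist G w (f v) = (dist G w v).+1.
  move=> wS; rewrite (dist_cut Gc vfv _ wS fvN) ?distxx ?addn0 // => a b.
  exact: subtree_cut.
have dout w : w \notin subtree v -> dist G w v = (dist G w (f v)).+1.
  move=> wS; rewrite (dist_cut (S := ~: subtree v) (a := f v) (b := v) Gc);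
    rewrite ?distxx ?addn0 ?in_setC ?wS ?vS //.
    by rewrite Gs.
  move=> a b Gab; rewrite !in_setC negbK => aS bS.
  by have [] := @subtree_cut v b a hv _ bS aS; rewrite 1?Gs.
have sym0 : dist G (f v) (f v) = 0 /\ dist G v v = 0 by rewrite !distxx.
split; rewrite um_m_E.
  rewrite (cardsD1 v) vS /= -sum1_card [RHS]big_mkcond; apply: eq_bigr => w _.
  rewrite 2!inE; have [->|wv] := eqVneq w v.
    by case: sym0 => -> ->; rewrite minn0.
  have [wS|wS] := boolP (w \in subtree v).
    have fS : f w \in subtree v by rewrite subtree_f.
    by rewrite !din //=; lia.
  have fS : f w \notin subtree v by rewrite subtree_f.
  by rewrite !(dout _ wS) !(dout _ fS) /=; lia.
have -> : n - #|subtree v| = #|~: subtree v|.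
  by have := cardsC (subtree v); rewrite card_ord; lia.
rewrite -sum1_card [RHS]big_mkcond; apply: eq_bigr => w _; rewrite in_setC.
have [->|wv] := eqVneq w v; first by case: sym0 => -> ->; rewrite minn0 min0n vS.
have [wS|wS] := boolP (w \in subtree v).
  have fS : f w \in subtree v by rewrite subtree_f.
  by rewrite !din //=; lia.
have fS : f w \notin subtree v by rewrite subtree_f.
by rewrite !(dout _ wS) !(dout _ fS) /=; lia.
Qed.

Lemma um_cyc_sum (F : 'I_n -> nat) : \sum_(w | h w == 0) F w = \sum_(i < k) F (c i).
Proof.
rewrite (reindex_onto (fun i : 'I_k => c i) (fun w => Ordinal (um_p M w))).
  2: by move=> w /eqP hw; exact: um_pK M _ hw.
apply: eq_bigl => i; have [-> pi] := um_c M (ltn_ord i).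
by rewrite eqxx; apply/eqP/val_inj.
Qed.

(* The non-cycle edges nearer to the first (resp. second) end of the [i]-th
   cycle edge, an edge [w, f w] being counted through its upper end [w]. *)
Definition WL i := \sum_(w | 0 < h w) (fwd k (p w) i < r).
Definition WR i := \sum_(w | 0 < h w) (0 < fwd k i (p w) <= r).

(** For a non-cycle edge the height cancels and the cyclic distance from [p w] decides; the cycle
    edges contribute [q] on each side. *)
Lemma um_m_cyc i : i < k ->
  m_ G (c i) (f (c i)) = q + WL i /\ m_ G (f (c i)) (c i) = q + WR i.
Proof.
move=> ik; have k2 := um_k M.
pose j := cnext k i; have jk : j < k by apply: cnext_lt.
have qk : q < k by lia.
rewrite um_f_cyc // -/j !um_m_E.
have split0 (F : 'I_n -> nat) :
    \sum_w F w = \sum_(w | h w == 0) F w + \sum_(w | 0 < h w) F w.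
  by rewrite (bigID (fun w => h w == 0)) /=; congr (_ + _);
     apply: eq_bigl => w; rewrite lt0n.
have dtree a w : a < k -> 0 < h w ->
    minn (dist G w (c a)) (dist G (f w) (c a)) = (h w).-1 + cdist k (p w) a.
  by move=> ak hw; have [hf pf] := um_tree M hw; rewrite !um_dist_cyc // pf; lia.
have dcyc a b : a < k -> b < k -> minn (dist G (c b) (c a)) (dist G (f (c b)) (c a)) =
    minn (cdist k b a) (cdist k (cnext k b) a).
  move=> ak bk; have b'k := cnext_lt bk.
  by rewrite um_f_cyc // !um_dist_cyc // !(um_c M _).1 // !(um_c M _).2.
split; rewrite split0; congr (_ + _).
- rewrite um_cyc_sum -[RHS](sum_pos_le qk) -(sum_fwdl (fun y => (0 < y <= q) : nat) ik).
  by apply: eq_bigr => y _; rewrite !dcyc // cdist_edge_lt.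
- by apply: eq_bigr => w hw; rewrite !dtree // ltn_add2l cdist_lt_cnext // (um_p M).
- rewrite um_cyc_sum -[RHS](sum_pos_le qk) -(sum_fwdr (fun y => (0 < y <= q) : nat) ik).
  by apply: eq_bigr => y _; rewrite !dcyc // cdist_edge_gt.
by apply: eq_bigr => w hw; rewrite !dtree // ltn_add2l cdist_gt_cnext // (um_p M).
Qed.

Definition tree_sum := \sum_(v | 0 < h v) #|subtree v|.-1 * (n - #|subtree v|).
Definition cyc_sum := \sum_(i < k) (q + WL i) * (q + WR i).

Lemma um_Sz_E : Sz_e G = tree_sum + cyc_sum.
Proof.
rewrite um_Sz (bigID (fun w => 0 < h w)) /=; congr (_ + _).
  by apply: eq_bigr => v /um_m_tree[-> ->].
rewrite (eq_bigl (fun w => h w == 0)) => [|w]; last by rewrite -eqn0Ngt.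
by rewrite um_cyc_sum; apply: eq_bigr => i _; have [-> ->] := um_m_cyc (ltn_ord i).
Qed.

End Structure.

(** * The contribution of a geodesic *)

(** Rotates the numbering of the cycle, so that the arc of the geodesic can start at position
    [0]. *)
Lemma um_rebase n (G : rel 'I_n) k f h p c j :
  unicyclic_map G k f h p c -> j < k ->
  unicyclic_map G k f h (fun u => fwd k j (p u))
    (fun i => c (if j + i < k then j + i else j + i - k)).
Proof.
move=> M jk; have shift i : i < k -> (if j + i < k then j + i else j + i - k) < k.
  by move=> ik; case: ifP; lia.
split=> [||u|u /(um_tree M)[hu ->]//|u /[dup] h0 /(um_cyc M)[hu ->]|i ik|u h0].
- exact: um_adj M.
- exact: um_k M.
- by rewrite fwd_lt // (um_p M).
- by rewrite fwd_cnextr // (um_p M).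
- have [-> ->] := um_c M (shift _ ik); split=> //.
  by rewrite /fwd; case: (ltnP (j + i) k) => ?; case: ifP; lia.
have pk := um_p M u; rewrite -[RHS](um_pK M h0); congr c.
by rewrite /fwd; case: (leqP j (p u)) => ?; case: ifP; lia.
Qed.

Section Legs.
Variables (n k : nat) (G : rel 'I_n) (f : 'I_n -> 'I_n).
Variables (h p : 'I_n -> nat) (c : nat -> 'I_n).
Hypothesis M : unicyclic_map G k f h p c.
Implicit Types u v w : 'I_n.

(* Two disjoint descending paths from [u] and [v], of [a] and [b] tree edges,
   which form a path of [a + t + b] edges together with [t] cycle edges; when
   [t = 0] they meet at a common vertex, possibly off the cycle. *)
Record legs u v a b t : Prop := Legs {
  legs_a : a <= h u;
  legs_b : b <= h v;
  legs_t : fwd k (p u) (p v) = t;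
  legs_tk : t <= k./2;
  legs_off : h u - a = h v - b;
  legs_top : 0 < t -> h u = a;
  legs_disj : forall i j, i < a -> j < b -> iter i f u != iter j f v }.

Lemma legs_trunc u v a b t a' b' : legs u v a b t -> a' <= a -> b' <= b ->
  legs (iter (a - a') f u) (iter (b - b') f v) a' b' t.
Proof.
case=> au bv tE tk off top dj aa bb; split=> //; rewrite ?(um_h_iter M); try lia.
- by rewrite !(um_p_iter M) //; lia.
by move=> i j ia jb; rewrite -!iterD; apply: dj; lia.
Qed.

Lemma dist_iter m u : dist G u (iter m f u) <= m.
Proof.
have Gc := um_connected M; elim: m => [|m IH]; first by rewrite distxx.
have := dist_triangle Gc (iter m f u) u (iter m.+1 f u).
have := dist_edge (um_adjf M (iter m f u)); rewrite -iterS; lia.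
Qed.

(** The two descents agree at the cycle at the latest; [m] is the greatest height at which they
    agree, so the parts above it are disjoint. *)
Lemma legs_same u v : p u = p v ->
  exists a b, legs u v a b 0 /\ iter a f u = iter b f v.
Proof.
move=> puv.
pose P m := [&& m <= h u, m <= h v & iter (h u - m) f u == iter (h v - m) f v].
have exP : exists m, P m.
  by exists 0; rewrite /P !subn0 !(um_root M) puv eqxx.
have leP m : P m -> m <= h u by case/andP.
have [m /and3P[mu mv /eqP mE] mmax] := ex_maxnP exP leP.
exists (h u - m), (h v - m); split=> //; split=> //; try lia.
  by rewrite puv /fwd leqnn subnn.
move=> i j ia jb; apply/eqP => ij.
have hij : h u - i = h v - j by rewrite -!(um_h_iter M) ij.
have e1 : h u - (h u - i) = i by lia.
have e2 : h v - (h u - i) = j by lia.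
by have := mmax (h u - i); rewrite /P e1 e2 ij eqxx; lia.
Qed.

(** With equal cycle positions the legs meet inside one tree. Otherwise they run down to the cycle
    and the shorter arc joins them, after exchanging [u] and [v] if needed. The bound on [t] ensures
    that shortening the legs alone can reach total length [diameter G]. *)
Lemma legs_exist u v : exists u' v' a b t,
  [/\ legs u' v' a b t, dist G u v <= a + t + b & t <= diameter G].
Proof.
have Gc := um_connected M; have Gs := (um_simple M).1.
have [puv|puv] := eqVneq (p u) (p v).
  have [a [b [L ab]]] := legs_same puv; exists u, v, a, b, 0; split=> //.
  have := dist_triangle Gc (iter a f u) u v; have := dist_iter a u.
  by have := dist_iter b v; rewrite ab (dist_sym Gs Gc v); lia.
wlog le : u v puv / fwd k (p u) (p v) <= k./2.
  move=> W; have [|lt] := leqP (fwd k (p u) (p v)) k./2; first exact: W.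
  rewrite (dist_sym Gs Gc); apply: W; rewrite 1?eq_sym //.
  by have := um_p M u; have := um_p M v => pv pu; rewrite fwdC //; case: ifP; lia.
have pu := um_p M u; have pv := um_p M v.
have dE : cdist k (p u) (p v) = fwd k (p u) (p v) by rewrite cdistE //; lia.
exists u, v, (h u), (h v), (fwd k (p u) (p v)); split.
- split=> //; first by lia.
  move=> i j iu jv; apply: contra_neq puv => ij.
  by rewrite -(um_p_iter M (ltnW iu)) -(um_p_iter M (ltnW jv)) ij.
- rewrite -dE -(um_dist_cyc M u pv).
  apply: leq_trans (dist_triangle Gc (c (p v)) u v) _.
  by rewrite leq_add2l (dist_sym Gs Gc) -(um_root M) dist_iter.
rewrite -dE; have [hc pc] := um_c M pu; have := um_dist_cyc M (c (p u)) pv.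
rewrite hc pc add0n => <-; apply: leq_trans (leq_bigmax (c (p u))).
exact: (leq_bigmax (c (p v))).
Qed.

Lemma diameter_attained : exists u v, dist G u v = diameter G.
Proof.
have n0 : 0 < #|'I_n| by apply/card_gt0P; exists (c 0).
have [u uE] := eq_bigmax (fun u => \max_v dist G u v) n0.
have [v vE] := eq_bigmax (fun v => dist G u v) n0.
by exists u, v; rewrite /diameter uE vE.
Qed.

(* A diametral pair only yields [a + t + b >= diameter G], as distances are
   merely bounded above; shortening the legs at their free ends gives equality. *)
Lemma legs_diameter : exists u v a b t, legs u v a b t /\ a + t + b = diameter G.
Proof.
have [u [v uv]] := diameter_attained.
have [u' [v' [a [b [t [L]]]]]] := legs_exist u v; rewrite uv => le td.
pose a' := minn a (diameter G - t); pose b' := diameter G - t - a'.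
have aa : a' <= a by rewrite /a'; lia.
have bb : b' <= b by rewrite /b' /a'; lia.
exists (iter (a - a') f u'), (iter (b - b') f v'), a', b', t; split.
  exact: legs_trunc.
by rewrite /b' /a'; lia.
Qed.

End Legs.

(** The difference of the two sides is [(x - m) * (y - m)]; this also gives the equality case
    below. *)
Lemma mul_ge_min m x y : m <= x -> m <= y -> m * (x + y - m) <= x * y.
Proof.
move=> mx my; have [x' ->] : exists x', x = m + x' by exists (x - m); lia.
have [y' ->] : exists y', y = m + y' by exists (y - m); lia.
have -> : m + x' + (m + y') - m = m + x' + y' by lia.
nia.
Qed.

Lemma mul_eq_min m x y : m <= x -> m <= y -> x * y = m * (x + y - m) -> x = m \/ y = m.
Proof.
move=> mx my; have [x' ->] : exists x', x = m + x' by exists (x - m); lia.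
have [y' ->] : exists y', y = m + y' by exists (y - m); lia.
have -> : m + x' + (m + y') - m = m + x' + y' by lia.
case: x' {mx} => [|x']; first by left; lia.
case: y' {my} => [|y']; first by right; lia.
nia.
Qed.

(* A bridge splits the other [n - 1] edges in two parts; for the [i]-th edge of a
   geodesic of [d] edges these have at least [i] and [d - 1 - i] elements. *)
Definition path_term n d i := let j := minn i (d.-1 - i) in j * (n.-1 - j).

(** * Lower bound for the bridges on the legs *)

Section TreeSum.
Variables (n k : nat) (G : rel 'I_n) (f : 'I_n -> 'I_n).
Variables (h p : 'I_n -> nat) (c : nat -> 'I_n).
Hypothesis M : unicyclic_map G k f h p c.
Implicit Types u v w : 'I_n.
Local Notation sub := (subtree f h).

Definition leg u a := [set iter i f u | i : 'I_a].

Lemma mem_leg u a i : i < a -> iter i f u \in leg u a.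
Proof. by move=> ia; apply/imsetP; exists (Ordinal ia). Qed.

Lemma legP u a w : w \in leg u a -> exists2 i, i < a & w = iter i f u.
Proof. by case/imsetP => i _ ->; exists i. Qed.

Lemma leg_mem u a w : a <= h u -> w \in leg u a ->
  [/\ 0 < h w, p w = p u, h u - h w < a & w = iter (h u - h w) f u].
Proof.
move=> au /legP[i ia ->]; rewrite (um_h_iter M) (um_p_iter M); last by lia.
have e : h u - (h u - i) = i by lia.
by rewrite e; split=> //; lia.
Qed.

Lemma leg_sum u a (F : 'I_n -> nat) : a <= h u ->
  \sum_(w | 0 < h w) (if w \in leg u a then F w else 0) = \sum_(i < a) F (iter i f u).
Proof.
move=> au; rewrite -big_mkcondr.
rewrite -[RHS](@big_imset _ _ _ _ _ (fun i : 'I_a => iter i f u) predT F) /=; last first.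
  move=> i j _ _ /= ij; apply: val_inj => /=; have := congr1 h ij.
  by rewrite !(um_h_iter M); have := ltn_ord i; have := ltn_ord j; lia.
apply: eq_bigl => w; rewrite -/(leg u a).
have [/(leg_mem au)[->]//|] := boolP (w \in leg u a).
by rewrite andbF.
Qed.

Lemma card_leg u a : a <= h u -> #|leg u a| = a.
Proof.
move=> au; rewrite -sum1_card big_mkcond /=.
have := leg_sum (fun=> 1) au; rewrite sum1_card card_ord => {2}<-.
rewrite [RHS]big_mkcond; apply: eq_bigr => w _; case: ifP => [/(leg_mem au)[->]//|_].
by case: ifP.
Qed.

Lemma card_cyc : #|[set w | h w == 0]| = k.
Proof. by rewrite -sum1dep_card (um_cyc_sum M) sum1_card card_ord. Qed.

Lemma card_tree : #|[set w | 0 < h w]| = n - k.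
Proof.
rewrite -card_cyc; have := cardsC [set w | h w == 0]; rewrite card_ord => E.
suff -> : [set w | 0 < h w] = ~: [set w | h w == 0] by lia.
by apply/setP=> w; rewrite !inE lt0n.
Qed.

Lemma subtree_leg u a i : i < a -> a <= h u -> i < #|sub (iter i f u)|.
Proof.
move=> ia au; rewrite -(@card_leg u i.+1); last by lia.
apply/subset_leq_card/subsetP => w /legP[j ji ->]; rewrite inE !(um_h_iter M).
apply/andP; split; first by lia.
have -> : h u - j - (h u - i) = i - j by lia.
by rewrite -iterD subnK.
Qed.

(** Outside the subtree lie the lower part [A] of the same leg, the other leg and the cycle, which
    are pairwise disjoint. *)
Lemma subtree_leg_out u v a b i : a <= h u -> b <= h v -> h u - a = h v - b ->
  (forall i j, i < a -> j < b -> iter i f u != iter j f v) -> i < a ->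
  #|sub (iter i f u)| + (a.-1 - i + b + k) <= n.
Proof.
move=> au bv off dj ia; set w := iter i f u.
have hw : h w = h u - i by rewrite /w (um_h_iter M).
pose A := leg (iter i.+1 f u) (a.-1 - i).
have hA : a.-1 - i <= h (iter i.+1 f u) by rewrite (um_h_iter M); lia.
pose X := A :|: leg v b :|: [set w | h w == 0].
have cX : #|X| = a.-1 - i + b + k.
  rewrite cardsU cardsU !card_leg // card_cyc.
  have -> : A :&: leg v b = set0.
    apply/setP=> x; rewrite !inE; apply/negP => /andP[/legP[j ja ->] /legP[j' jb]].
    by rewrite -iterD => E; have := dj (j + i.+1) j'; rewrite E eqxx; lia.
  have -> : (A :|: leg v b) :&: [set w | h w == 0] = set0.
    apply/setP=> x; rewrite !inE; apply/negP => /andP[xL hx].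
    case/orP: xL => [/(leg_mem hA)|/(leg_mem bv)] [];
    by rewrite (eqP hx).
  by rewrite cards0; lia.
rewrite -cX -[n in _ <= n]card_ord -(cardsC (sub w)) leq_add2l.
apply/subset_leq_card/subsetP => x; rewrite !in_setU in_setC => xX.
apply/negP; rewrite inE => /andP[hwx /eqP xw].
case/orP: xX => [/orP[/(leg_mem hA)[_ _ _ xE]|/(leg_mem bv)[_ _ lt xE]]|].
- by move: hwx hw; rewrite xE !(um_h_iter M); lia.
- have hxv : h x <= h v by rewrite xE (um_h_iter M) leq_subr.
  have xw' : iter (h v - h w) f v = w.
    by rewrite -[RHS]xw {2}xE -iterD; congr iter; lia.
  have lt' : h v - h w < b by lia.
  by have := dj _ _ ia lt'; rewrite xw' eqxx.
by rewrite inE => /eqP hx; move: hwx; rewrite hx hw; lia.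
Qed.

Lemma subtree_lt w : 0 < #|sub w|.
Proof. by apply/card_gt0P; exists w; apply: subtree_self. Qed.

Lemma subtree_cyc w : 0 < h w -> #|sub w| + k <= n.
Proof.
move=> hw; rewrite -card_cyc -[n in _ <= n]card_ord -(cardsC (sub w)) leq_add2l.
by apply/subset_leq_card/subsetP => x; rewrite inE in_setC !inE => /eqP ->; lia.
Qed.

Variables (u v : 'I_n) (a b t d : nat).
Hypotheses (L : legs k f h p u v a b t) (abd : a + t + b = d).

(** The legs are disjoint, so at most one summand is nonzero. Bounding vertex by vertex lets
    equality of the sums be read off term by term. *)
Definition leg_bound w :=
  (if w \in leg u a then path_term n d (h u - h w) else 0) +
  (if w \in leg v b then path_term n d (h v - h w) else 0).

Let tk : t < k.
Proof. by have := legs_tk L; have := um_k M; lia. Qed.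

(** One side of the bridge has at least [s] edges, the other at least [i + y + k], hence at least
    [d.-1 - s] because [t < k]. So [mul_ge_min] applies. *)
Lemma path_term_le_leg x y s i : #|sub x| + (i + y + k) <= n -> s < #|sub x| ->
  s + y + i + t = d.-1 -> path_term n d s <= #|sub x|.-1 * (n - #|sub x|).
Proof.
move=> le lt e; rewrite /path_term.
have -> : n.-1 = #|sub x|.-1 + (n - #|sub x|) by lia.
by apply: mul_ge_min; lia.
Qed.

Lemma leg_bound_le w : 0 < h w -> leg_bound w <= #|sub w|.-1 * (n - #|sub w|).
Proof.
move=> hw; case: (L) => au bv _ _ off _ dj; rewrite /leg_bound.
have dj' i j : i < b -> j < a -> iter i f v != iter j f u.
  by move=> ib ja; rewrite eq_sym; apply: dj.
have [/(leg_mem au)[_ _ lt wE]|_] := boolP (w \in leg u a); last first.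
  have [/(leg_mem bv)[_ _ lt wE]|_ //] := boolP (w \in leg v b).
  have := subtree_leg lt bv; have := subtree_leg_out bv au (esym off) dj' lt.
  by rewrite add0n -wE => *; apply: (@path_term_le_leg w a _ (b.-1 - (h v - h w))); lia.
have [/(leg_mem bv)[_ _ lt' wE']|_ //] := boolP (w \in leg v b).
  by have := dj _ _ lt lt'; rewrite -wE -wE' eqxx.
have := subtree_leg lt au; have := subtree_leg_out au bv off dj lt.
by rewrite addn0 -wE => *; apply: (@path_term_le_leg w b _ (a.-1 - (h u - h w))); lia.
Qed.

Lemma leg_bound_sum : \sum_(w | 0 < h w) leg_bound w =
  \sum_(i < a) path_term n d i + \sum_(i < b) path_term n d i.
Proof.
have [au bv] := (legs_a L, legs_b L); rewrite big_split /=.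
rewrite (leg_sum (fun w => path_term n d (h u - h w)) au).
rewrite (leg_sum (fun w => path_term n d (h v - h w)) bv).
by congr (_ + _); apply: eq_bigr => i _;
   rewrite (um_h_iter M) subKn //; have := ltn_ord i; lia.
Qed.

Lemma tree_sum_ge :
  \sum_(i < a) path_term n d i + \sum_(i < b) path_term n d i <= tree_sum f h.
Proof. by rewrite -leg_bound_sum; apply: leq_sum => w; apply: leg_bound_le. Qed.

Lemma tree_sum_eq :
  \sum_(i < a) path_term n d i + \sum_(i < b) path_term n d i = tree_sum f h ->
  forall w, 0 < h w -> #|sub w|.-1 * (n - #|sub w|) = leg_bound w.
Proof.
rewrite -leg_bound_sum => E w hw.
have := leqif_sum (fun w (hw : 0 < h w) => leqif_eq (leg_bound_le hw)).
case=> _; rewrite -/(tree_sum f h) E eqxx => /esym /forall_inP H.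
by apply/esym/eqP/H.
Qed.

End TreeSum.

(** * The contribution of the cycle *)

Section CycleSum.
Variables (n k : nat) (G : rel 'I_n) (f : 'I_n -> 'I_n).
Variables (h p : 'I_n -> nat) (c : nat -> 'I_n).
Hypothesis M : unicyclic_map G k f h p c.

Local Notation WL := (WL k h p).
Local Notation WR := (WR k h p).
Local Notation N := (n - k).

Definition weight y := \sum_(w | 0 < h w) (p w == y).

Lemma um_k_le : k <= n.
Proof.
have := card_cyc M; have := max_card (mem [set w | h w == 0]).
by rewrite card_ord => + <-.
Qed.

Lemma sum_tree_const x : \sum_(w | 0 < h w) x = N * x.
Proof. by rewrite sum_nat_const -(card_tree M) cardsE. Qed.

(** Double counting: a fixed non-cycle edge is nearer to the first end for exactly [k./2] cycle
    edges. *)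
Lemma WL_sum : \sum_(i < k) WL i = N * k./2.
Proof.
rewrite exchange_big /= -sum_tree_const; apply: eq_bigr => w _.
rewrite (sum_fwdr (fun x => (x < k./2) : nat) (um_p M w)) sum_lt //; lia.
Qed.

Lemma WR_sum : \sum_(i < k) WR i = N * k./2.
Proof.
have k2 := um_k M; rewrite exchange_big /= -sum_tree_const; apply: eq_bigr => w _.
rewrite (sum_fwdl (fun x => (0 < x <= k./2) : nat) (um_p M w)) sum_pos_le //; lia.
Qed.

Lemma cyc_sumE : cyc_sum k h p =
  k * (k.-1./2 * k.-1./2) + 2 * (k.-1./2 * (N * k./2)) + \sum_(i < k) WL i * WR i.
Proof.
rewrite /cyc_sum; under eq_bigr => i _ do rewrite mulnDr !mulnDl addnACA.
rewrite !big_split /= sum_nat_const card_ord -!addnA; congr (_ + _).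
rewrite -big_distrr -big_distrl /= WL_sum WR_sum; lia.
Qed.

Lemma weight_le_WL y i : fwd k y i < k./2 -> weight y <= WL i.
Proof. by move=> lt; apply: leq_sum => w _; case: eqP => // ->; rewrite lt. Qed.

Lemma weight_le_WR y i : 0 < fwd k i y <= k./2 -> weight y <= WR i.
Proof. by move=> lt; apply: leq_sum => w _; case: eqP => // ->; rewrite lt. Qed.

Lemma WLR_even i : ~~ odd k -> i < k -> WL i + WR i = N.
Proof.
move=> ek ik; rewrite -big_split /= -[RHS]muln1 -sum_tree_const; apply: eq_bigr => w _.
have pk := um_p M w; rewrite (fwdC pk ik); have := fwd_lt pk ik.
by case: ifP; lia.
Qed.

(** In an odd cycle exactly one position [y] is equally far from both ends of a cycle edge; in an
    even cycle there is none. *)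
Lemma WLR_odd i y : odd k -> i < k -> y < k -> fwd k y i = k./2 ->
  WL i + WR i + weight y = N.
Proof.
move=> ek ik yk yi; have k2 := um_k M.
rewrite -!big_split /= -[RHS]muln1 -sum_tree_const; apply: eq_bigr => w _.
have pk := um_p M w; rewrite (fwdC pk ik).
have -> : (p w == y) = (fwd k (p w) i == k./2).
  by move: yi; rewrite /fwd; repeat case: ifP => ?; lia.
by have := fwd_lt pk ik; case: ifP; lia.
Qed.

Lemma leg_weight u a : a <= h u -> a <= weight (p u).
Proof.
move=> au; rewrite -{1}(card_leg M au) -sum1_card /weight -big_mkcondr /=.
rewrite [X in X <= _]big_mkcond [X in _ <= X]big_mkcond /=; apply: leq_sum => w _.
by case: ifP => // /(leg_mem M au)[-> -> _ _]; rewrite eqxx.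
Qed.

Section Arc.
Variables t m : nat.
Hypotheses (tk : t <= k./2) (m0 : m <= weight 0) (mt : m <= weight t).

(* The [l]-th cycle edge is paired with the opposite one.  In an odd cycle the
   tree edges attached to the vertex opposite to the [l]-th edge are lost in
   [WL l + WR l], but they are recovered from the paired edge. *)
Lemma cross_pair l : l < t ->
  (if odd k then 1 else 2) * (m * (N - m)) <=
  WL l * WR l + WL (l + (k - k./2)) * WR (l + (k - k./2)).
Proof.
move=> lt; have k2 := um_k M; set l' := l + (k - k./2).
have lk : l < k by lia.
have l'k : l' < k by rewrite /l'; lia.
have L0 : weight 0 <= WL l by apply: weight_le_WL; rewrite /fwd leq0n; lia.
have Rt : weight t <= WR l by apply: weight_le_WR; rewrite /fwd; case: ifP; lia.
have R0 : weight 0 <= WR l' by apply: weight_le_WR; rewrite /fwd /l'; case: ifP; lia.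
have [ok|ek] := boolP (odd k).
  have yi : fwd k l' l = k./2 by rewrite /fwd /l'; case: ifP; lia.
  have E := WLR_odd ok lk l'k yi.
  have Ly : weight l' <= WL l' by apply: weight_le_WL; rewrite /fwd leqnn; lia.
  have := @mul_ge_min m (WL l) (WR l).
  have -> : WL l + WR l - m = N - m - weight l' by lia.
  have mm : weight l' * m <= WL l' * WR l' by apply: leq_mul; lia.
  move=> /(_ (leq_trans m0 L0) (leq_trans mt Rt)) H.
  rewrite mul1n; apply: leq_trans (leq_add H mm).
  by rewrite [weight l' * m]mulnC -mulnDr leq_mul2l; lia.
have Lt : weight t <= WL l' by apply: weight_le_WL; rewrite /fwd /l'; case: ifP; lia.
have e1 := WLR_even ek lk; have e2 := WLR_even ek l'k.
rewrite mul2n -addnn -{1}e1 -e2; apply: leq_add; apply: mul_ge_min; lia.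
Qed.

(** Only [t] pairs are kept: as [t <= k./2 <= k - k./2], the indices [l] and their partners
    [l + (k - k./2)] form disjoint ranges below [k]. *)
Lemma cross_sum :
  t * ((if odd k then 1 else 2) * (m * (N - m))) <= \sum_(i < k) WL i * WR i.
Proof.
have k2 := um_k M; rewrite -(big_mkord xpredT (fun i => WL i * WR i)).
rewrite (big_cat_nat (n := k - k./2)) ?leq_subr //=.
rewrite (big_cat_nat (n := t)) //=; last by lia.
rewrite [X in _ + X](big_cat_nat (n := t + (k - k./2))) /=; try lia.
have -> : \sum_(k - k./2 <= i < t + (k - k./2)) WL i * WR i =
    \sum_(0 <= l < t) WL (l + (k - k./2)) * WR (l + (k - k./2)).
  by rewrite -{1}[k - k./2]add0n big_addn addnK.
set F := (if _ then _ else _) * _.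
have : \sum_(0 <= l < t) F <=
    \sum_(0 <= l < t) (WL l * WR l + WL (l + (k - k./2)) * WR (l + (k - k./2))).
  by rewrite !big_mkord; apply: leq_sum => i _; apply: cross_pair.
by rewrite big_split /= sum_nat_const_nat subn0; lia.
Qed.

End Arc.

End CycleSum.

(** * Numerical comparison of arc edges with bridges *)

Lemma mul_sub_mono s j j' : j <= j' -> j + j' <= s -> j * (s - j) <= j' * (s - j').
Proof.
move=> /subnKC <-; move: (j' - j) => x /subnKC <-; move: (s - _) => y.
have -> : j + (j + x) + y - j = j + x + y by lia.
have -> : j + (j + x) + y - (j + x) = j + y by lia.
lia.
Qed.

Lemma path_term_rev n d i : i < d -> path_term n d (d.-1 - i) = path_term n d i.
Proof. by move=> id; rewrite /path_term subKn 1?minnC //; lia. Qed.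

Lemma path_term_arc n a t b l : l < t ->
  path_term n (a + t + b) (a + l) = path_term n (a + t + b) (b + (t.-1 - l)).
Proof. by move=> lt; rewrite -path_term_rev; [congr path_term|]; lia. Qed.

Lemma path_term_sum n a t b (d := a + t + b) :
  \sum_(i < d) path_term n d i =
  \sum_(i < a) path_term n d i + \sum_(l < t) path_term n d (a + l) +
  \sum_(i < b) path_term n d i.
Proof.
rewrite /d big_split_ord /= big_split_ord /= -/d; congr (_ + _).
rewrite [RHS](reindex_inj rev_ord_inj); apply: eq_bigr => i _ /=.
have ib := ltn_ord i; rewrite -path_term_rev; last by rewrite /d; lia.
by congr path_term; rewrite /d; lia.
Qed.

(** By symmetry [a <= b]. Replacing the minimum in [path_term] by the possibly larger [a + l] cannot
    decrease the product, as [x * (s - x)] grows up to [s / 2]. *)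
Lemma arc_sum_le N k a t b : a + b <= N -> t <= k./2 ->
  \sum_(l < t) path_term (N + k) (a + t + b) (a + l) <=
  \sum_(l < t) (minn a b + l) * (N + k.-1 - (minn a b + l)).
Proof.
move=> abN tk.
wlog ab : a b abN / a <= b.
  move=> W; case/orP: (leq_total a b) => [|ba]; first exact: W.
  rewrite minnC (_ : a + t + b = b + t + a); last by lia.
  rewrite (reindex_inj rev_ord_inj).
  apply: leq_trans (_ : _ <= _) (W b a _ ba); last by lia.
  apply: leq_sum => l _ /=; have lt := ltn_ord l.
  by rewrite [leqRHS]path_term_arc // (_ : t.-1 - l = t - l.+1) //; lia.
have -> : minn a b = a by lia.
apply: leq_sum => l _; have lt := ltn_ord l; rewrite /path_term.
have -> : (N + k).-1 = N + k.-1 by lia.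
by apply: mul_sub_mono; lia.
Qed.

Section ArcTerm.
Variables N m : nat.
Hypothesis mN : 2 * m <= N.

Lemma arc_term_odd r l : l < r ->
  (m + l) * (N + 2 * r - (m + l)) <= m * (N - m) + N * r + r * r.-1 + r.-1.
Proof.
move/subnKC <-; move: (r - _) => y; move: mN => /subnKC <-; move: (N - _) => x.
have -> : 2 * m + x + 2 * (l.+1 + y) - (m + l) = m + x + l + 2 + 2 * y by lia.
have -> : 2 * m + x - m = m + x by lia.
by rewrite addSn /=; nia.
Qed.

Lemma arc_sum_odd r t : t <= r ->
  \sum_(l < t) (m + l) * (N + 2 * r - (m + l)) <=
  t * (m * (N - m) + N * r + r * r.-1 + r.-1).
Proof.
move=> tr; rewrite -[t in X in _ <= X]card_ord -sum_nat_const; apply: leq_sum => l _.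
by apply: arc_term_odd => //; have := ltn_ord l; lia.
Qed.

(** Doubled to avoid halving the odd factor in [N * (2 * r).-1]; the first term gets a sharper bound
    than the others. *)
Lemma arc_term_even r l : l < r ->
  2 * ((m + l) * (N + (2 * r).-1 - (m + l))) <=
  2 * (m * (N - m)) + N * (2 * r).-1 + (if l == 0 then 0 else 2 * (r * r.-1)).
Proof.
move/subnKC <-; move: (r - _) => y; move: mN => /subnKC <-; move: (N - _) => x.
have -> : 2 * m + x + (2 * (l.+1 + y)).-1 - (m + l) = m + x + l + 1 + 2 * y by lia.
have -> : 2 * m + x - m = m + x by lia.
have -> : (2 * (l.+1 + y)).-1 = 2 * l + 2 * y + 1 by lia.
rewrite addSn /=; case: eqP => [->|_]; nia.
Qed.

Lemma arc_sum_even r t : 0 < t <= r ->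
  2 * \sum_(l < t) (m + l) * (N + (2 * r).-1 - (m + l)) <=
  t * (2 * (m * (N - m)) + N * (2 * r).-1) + t.-1 * (2 * (r * r.-1)).
Proof.
case: t => // t' tr; rewrite big_distrr big_ord_recl.
rewrite [t'.+1 * _]mulSn /= -addnA leq_add //.
  by apply: leq_trans (arc_term_even (r := r) _) _; rewrite ?addn0 //; lia.
rewrite -mulnDr -[t' in X in _ <= X]card_ord -sum_nat_const; apply: leq_sum => l _.
by apply: arc_term_even => //; rewrite /= /bump /=; have := ltn_ord l; lia.
Qed.

End ArcTerm.

(* The next four lemmas show that [C], a lower bound for the contribution of the
   cycle, exceeds the amount allowed by [Sz_min] unless the cycle is a triangle. *)
Lemma cycle_excess_odd N r a t b C : 1 < r -> t <= r -> a + b <= N -> 2 < a + t + b ->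
  (2 * r + 1) * (r * r) + 2 * (r * (N * r)) + t * (minn a b * (N - minn a b)) <= C ->
  \sum_(l < t) path_term (N + (2 * r + 1)) (a + t + b) (a + l)
    + (2 * (N + (2 * r + 1)) - 3 - 2 * (a + t + b).-1./2) < C.
Proof.
move=> r1 tr abN d2; apply: leq_trans; rewrite -addSn.
have tk : t <= (2 * r + 1)./2 by lia.
have := arc_sum_le abN tk; have -> : (2 * r + 1).-1 = 2 * r by lia.
have mN : 2 * minn a b <= N by lia.
move/leq_trans/(_ (arc_sum_odd mN tr)).
move: (minn a b * _) => X; move: (\sum_(_ < _) _) => S H.
have d1 : 0 < (a + t + b).-1./2 by lia.
(* [t * X] occurs on both sides and cancels; the rest grows with [t], so the comparison is made at
   [t = r]. *)
have le : t * (N * r + r * r.-1 + r.-1) <= r * (N * r + r * r.-1 + r.-1).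
  by rewrite leq_mul2r tr orbT.
suff : r * (N * r + r * r.-1 + r.-1) + (2 * N + 4 * r - 3) <
    (2 * r + 1) * (r * r) + 2 * (r * (N * r)).
  have : t * (X + N * r + r * r.-1 + r.-1) =
      t * X + t * (N * r + r * r.-1 + r.-1) by lia.
  by lia.
case: r r1 {tr H tk le} => // -[] // r _; rewrite /=; nia.
Qed.

Lemma cycle_excess_even N r a t b C :
  2 < r -> 0 < t <= r -> a + b <= N -> 2 < a + t + b ->
  2 * r * (r.-1 * r.-1) + 2 * (r.-1 * (N * r)) +
    t * (2 * (minn a b * (N - minn a b))) <= C ->
  \sum_(l < t) path_term (N + 2 * r) (a + t + b) (a + l)
    + (2 * (N + 2 * r) - 3 - 2 * (a + t + b).-1./2) < C.
Proof.
move=> r1 tr abN d2; apply: leq_trans; rewrite -addSn.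
have tk : t <= (2 * r)./2 by lia.
have := arc_sum_le abN tk.
have mN : 2 * minn a b <= N by lia.
have := arc_sum_even mN tr; move: (\sum_(_ < _) _ * _) => S'.
move: (minn a b * _) => X; move: (\sum_(_ < _) _) => S H' H.
have d1 : 0 < (a + t + b).-1./2 by lia.
have le : t * (N * (2 * r).-1) + t.-1 * (2 * (r * r.-1)) <=
  r * (N * (2 * r).-1) + r.-1 * (2 * (r * r.-1)).
  by rewrite leq_add // leq_mul2r; lia.
suff : r * (N * (2 * r).-1) + r.-1 * (2 * (r * r.-1)) + 2 * (2 * N + 4 * r - 5)
   < 2 * (2 * r * (r.-1 * r.-1) + 2 * (r.-1 * (N * r))).
  have : t * (2 * X + N * (2 * r).-1) = 2 * (t * X) + t * (N * (2 * r).-1) by lia.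
  have : t * (2 * X) = 2 * (t * X) by lia.
  by lia.
case: r r1 {tr H H' tk le} => // -[] // -[] // r _.
by rewrite (_ : (2 * r.+3).-1 = 2 * r + 5) /=; [nia|lia].
Qed.

Lemma cycle_excess4 N a t b C : 1 < N -> 0 < t <= 2 -> a + b <= N -> 2 < a + t + b ->
  4 * (N + 1) + t * (2 * (minn a b * (N - minn a b))) <= C ->
  \sum_(l < t) path_term (N + 4) (a + t + b) (a + l)
    + (2 * (N + 4) - 3 - 2 * (a + t + b).-1./2) < C.
Proof.
move=> N1 t2 abN d2; apply: leq_trans; rewrite -addSn.
have d1 : 0 < (a + t + b).-1./2 by lia.
have H := @arc_sum_le N 4 a t b.
(* If [a = b], then [t <= 2] makes the minimum equal to [a] for every arc edge. Otherwise
   [2 * minn a b < N], and this strictness gives the slack for the general bound. *)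
have [ab|ab] := eqVneq a b.
  have {H}-> : \sum_(l < t) path_term (N + 4) (a + t + b) (a + l) =
      t * (a * (N + 3 - a)).
    rewrite -[t in RHS]card_ord -sum_nat_const.
    apply: eq_bigr => l _; rewrite /path_term.
    have -> : minn (a + l) ((a + t + b).-1 - (a + l)) = a by have := ltn_ord l; lia.
    by congr (_ * _); lia.
  move: d1; rewrite -ab minnn => d1.
  have [x E] : exists x, N = 2 * a + x by exists (N - 2 * a); lia.
  have -> : N + 3 - a = a + x + 3 by lia.
  have -> : N - a = a + x by lia.
  have [te|te] : t = 1 \/ t = 2 by lia.
    by rewrite te in d1 *; nia.
  by rewrite te in d1 *; nia.
have {}H := H abN ltac:(lia); apply: leq_ltn_trans (leq_add H (leqnn _)) _.
have mN : 2 * minn a b < N by lia.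
move: (minn a b) mN {H ab} => m mN.
have [x E] : exists x, N = 2 * m + 1 + x by exists (N - (2 * m + 1)); lia.
have e1 : N + 3 - m = m + x + 4 by lia.
have e2 : N + 3 - (m + 1) = m + x + 3 by lia.
have e3 : N - m = m + x + 1 by lia.
have [te | te] : t = 1 \/ t = 2 by lia.
  rewrite te in d1 *; rewrite big_ord1 addn0 /= e1 e3; nia.
rewrite te in d1 *; rewrite big_ord_recl big_ord1 /= addn0 /bump /= e1 e2 e3; nia.
Qed.

Lemma cycle_excess0 N k b C : 2 < k -> 0 < b ->
  k * (k.-1./2 * k.-1./2) + 2 * (k.-1./2 * (N * k./2)) <= C ->
  2 * (N + k) - 3 - 2 * b < C.
Proof.
move=> k2 b0; apply: leq_trans.
have [q q0 kE] : exists2 q, 0 < q & k = 2 * q + 1 \/ k = 2 * q + 2.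
  by exists k.-1./2; lia.
have -> : k.-1./2 = q by lia.
have [r rE] : exists r, k./2 = q + r by exists (k./2 - q); lia.
rewrite rE; case: q q0 kE {rE} => // q _ kE.
have H1 : N * 2 <= 2 * (q.+1 * (N * (q.+1 + r))) by nia.
have H2 : 2 * k - 4 <= k * (q.+1 * q.+1) by case: kE => ->; nia.
lia.
Qed.

(** The left side splits as [m * (w0 + w1 - m) + w2 * m + 2 * m], bounded by [w0 * w1], [w2 * w0]
    and [2 * s]. Equality forces [m = s > 0] and [w1 * w2 = 0], hence [w2 = 0] as [m <= w1], and
    then [mul_eq_min] applies. *)
Lemma triangle_core a b w0 w1 w2 (m := minn a b) (s := (a + b)./2) :
  0 < s -> a <= w0 -> b <= w1 ->
  m * (w0 + w1 + w2 - m) + 2 * m <= w0 * w1 + w1 * w2 + w2 * w0 + 2 * s /\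
  (m * (w0 + w1 + w2 - m) + 2 * m = w0 * w1 + w1 * w2 + w2 * w0 + 2 * s ->
   [/\ m = s, w2 = 0 & w0 = m \/ w1 = m]).
Proof.
move=> s0 aw bw; have ms : m <= s by rewrite /m /s; lia.
have m0 : m <= w0 by rewrite /m; lia.
have m1 : m <= w1 by rewrite /m; lia.
have H := mul_ge_min m0 m1; have E := mul_eq_min m0 m1.
have e : m * (w0 + w1 + w2 - m) = m * (w0 + w1 - m) + w2 * m.
  by rewrite mulnC [w2 * _]mulnC -mulnDr mulnC; congr (_ * _); lia.
rewrite e; have H2 : w2 * m <= w2 * w0 by rewrite leq_mul2l m0 orbT.
split; first by lia.
move=> eq; have sm : m = s by lia.
have w20 : w2 = 0.
  have /eqP : w1 * w2 = 0 by lia.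
  rewrite muln_eq0 => /orP[] /eqP; lia.
by split=> //; apply: E; lia.
Qed.

(** All [d] geodesic edges counted as bridges, plus the excess forced by the cycle; the extremal
    graph attains this value. *)
Definition Sz_min n d := \sum_(i < d) path_term n d i + (2 * n - 3 - 2 * d.-1./2).

(** * The lower bound and its equality conditions *)

Section LowerBound.
Variables (n k : nat) (G : rel 'I_n) (f : 'I_n -> 'I_n).
Variables (h p : 'I_n -> nat) (c : nat -> 'I_n).
Hypothesis M : unicyclic_map G k f h p c.

(** In a triangle [WL i] and [WR i] are the weights at the two ends of edge [i], the opposite vertex
    being neutral. The constant is [3 + 2 * (n - 3)]. *)
Lemma cyc_sum3 : k = 3 -> 
  let w := weight h p in
  w 0 + w 1 + w 2 = n - 3 /\
  cyc_sum k h p = 2 * n - 3 + (w 0 * w 1 + w 1 * w 2 + w 2 * w 0).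
Proof.
move=> k3 w; have kn := um_k_le M; have p3 x : p x < 3 by rewrite -k3 (um_p M).
have W i j : (forall x, x < 3 -> (fwd k x i < k./2) = (x == j)) -> WL k h p i = w j.
  by move=> E; apply: eq_bigr => x _; rewrite E.
have W' i j : (forall x, x < 3 -> (0 < fwd k i x <= k./2) = (x == j)) ->
    WR k h p i = w j.
  by move=> E; apply: eq_bigr => x _; rewrite E.
have s : w 0 + w 1 + w 2 = n - 3.
  rewrite /w /weight -!big_split /= -k3 -[RHS]muln1 -(sum_tree_const M).
  by apply: eq_bigr => x _; have := p3 x; case: (p x) => [|[|[|]]].
split=> //; rewrite (cyc_sumE M) k3 in W W' kn *.
rewrite !big_ord_recl big_ord0 /= /bump /=.
rewrite (@W 0 0) ?(@W 1 1) ?(@W 2 2) ?(@W' 0 1) ?(@W' 1 2) ?(@W' 2 0); first by lia.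
all: by case=> [|[|[|]]].
Qed.

Variables (u v : 'I_n) (a b t : nat).
Hypotheses (L : legs k f h p u v a b t) (pu : p u = 0) (n5 : 5 < n).
Local Notation d := (a + t + b).
Hypothesis d2 : 2 < d.

Local Notation N := (n - k).
Let nE : n = N + k. Proof. by have := um_k_le M; lia. Qed.

Lemma legs_pv : p v = t.
Proof. by have := legs_t L; rewrite pu /fwd leq0n subn0. Qed.

Lemma legs_le_weight : a <= weight h p 0 /\ b <= weight h p t.
Proof.
by rewrite -{1}pu -legs_pv; split; apply: (leg_weight M);
   [have := legs_a L|have := legs_b L].
Qed.

(** The tree at position [0] is nearer to the first end of cycle edge [0], the tree at [t] to its
    second end, so the legs are counted on different sides. *)
Lemma legs_le_tree : 0 < t -> a + b <= N.
Proof.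
move=> t0; have tk := legs_tk L; have k2 := um_k M; have [wa wb] := legs_le_weight.
have k0 : 0 < k by lia.
have H1 : weight h p 0 <= WL k h p 0 by apply: (weight_le_WL); rewrite /fwd leqnn; lia.
have H2 : weight h p t <= WR k h p 0 by apply: (weight_le_WR); rewrite /fwd leq0n; lia.
have : WL k h p 0 + WR k h p 0 <= N.
  have [ok|ek] := boolP (odd k); last by rewrite (WLR_even M).
  by rewrite -(@WLR_odd _ _ _ _ _ _ _ M 0 (k - k./2)) ?leq_addr //;
     rewrite /fwd; [|case: ifP]; lia.
lia.
Qed.

Lemma cyc_sum_gt : 3 < k \/ t = 0 ->
  \sum_(l < t) path_term n d (a + l) + (2 * n - 3 - 2 * d.-1./2) < cyc_sum k h p.
Proof.
move=> kt; have k2 := um_k M; have tk := legs_tk L.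
rewrite (cyc_sumE M); have [t0|t0] := posnP t.
  rewrite t0 big_ord0 add0n {1}nE; apply: (@cycle_excess0 _ _ _ _ k2); first by lia.
  by rewrite leq_addr.
have {kt}k3 : 3 < k by lia.
have abN := legs_le_tree t0; have [wa wb] := legs_le_weight.
have := @cross_sum _ _ _ _ _ _ _ M t (minn a b) tk _ _.
move=> /(_ ltac:(lia) ltac:(lia)).
move: (\sum_(i < k) _) => X HX.
move: nE (n5); move: N abN HX => N' abN HX -> n5'.
have [ok|ek] := boolP (odd k).
  have [r kE] : exists r, k = 2 * r + 1 by exists k./2; lia.
  move: HX; rewrite ok kE; have -> : (2 * r + 1).-1./2 = r by lia.
  have -> : (2 * r + 1)./2 = r by lia.
  by rewrite mul1n => HX; apply: cycle_excess_odd; lia.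
have [r kE] : exists r, k = 2 * r by exists k./2; lia.
move: HX; rewrite (negPf ek) kE; have -> : (2 * r).-1./2 = r.-1 by lia.
have -> : (2 * r)./2 = r by lia.
move=> HX; have [r2|r3] : r = 2 \/ 2 < r by lia.
  by rewrite r2 in HX kE tk *; apply: cycle_excess4; lia.
by apply: cycle_excess_even; lia.
Qed.

(** Leg bridges and cycle edges are bounded separately. Unless [k = 3] and [t = 1] the cycle bound
    is strict; the remaining case is [triangle_core]. *)
Lemma Sz_ge : Sz_min n d <= Sz_e G /\
  (Sz_e G = Sz_min n d ->
  [/\ k = 3 /\ t = 1, minn a b = (a + b)./2, weight h p 2 = 0,
    weight h p 0 = minn a b \/ weight h p 1 = minn a b &
    forall w, 0 < h w ->
      #|subtree f h w|.-1 * (n - #|subtree f h w|) = leg_bound f h u v a b d w]).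
Proof.
rewrite (um_Sz_E M) /Sz_min path_term_sum.
have H := tree_sum_ge M L (erefl d); have E := tree_sum_eq M L (erefl d).
have [kt|kt] := boolP ((3 < k) || (t == 0)).
  by have := @cyc_sum_gt ltac:(lia); split; lia.
have k2 := um_k M; have tk := legs_tk L; have k3 : k = 3 by lia.
have t1 : t = 1 by move: tk; rewrite k3; lia.
have [wa wb] := legs_le_weight; have [ws ->] := cyc_sum3 k3.
have d1 : 0 < (a + b)./2 by lia.
rewrite t1 in wb H E *; have [C1 C2] := triangle_core (weight h p 2) d1 wa wb.
have sE : (a + 1 + b).-1./2 = (a + b)./2 by congr _./2; lia.
have pE : path_term n (a + 1 + b) a = minn a b * (n - 1 - minn a b).
  by rewrite /path_term (_ : (a + 1 + b).-1 - a = b) ?subn1 //; lia.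
rewrite big_ord1 addn0 pE sE.
(* [n - 1] is the total weight plus [2], which turns the bridge value of the triangle edge into the
   left side of [triangle_core]. *)
have mE : minn a b * (n - 1 - minn a b) =
    minn a b * (weight h p 0 + weight h p 1 + weight h p 2 - minn a b) +
    2 * minn a b.
  by rewrite [2 * _]mulnC -mulnDr; congr (_ * _); have := um_k_le M; lia.
rewrite -mE in C1 C2; split; first by lia.
by move=> eq; have [|m2 w2 w01] := C2; [lia|split=> //; apply: E; lia].
Qed.

End LowerBound.

(** * The extremal graph *)

(* The parent map of the extremal graph; [e] selects the direction in which the
   triangle is traversed. *)
Definition cmap (e : bool) d j :=
  if j < 3 then (if e then cnext 3 j else if j == 0 then 2 else j.-1) else cparent d j.

Lemma cadj_cmap e d i j :
  cadj d i j || cadj d j i = (cmap e d i == j) || (cmap e d j == i).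
Proof.
rewrite /cadj /cmap; have [i3|i3] := ltnP i 3; have [j3|j3] := ltnP j 3 => /=.
- by case: e i j i3 j3 => -[|[|[|]]] // [|[|[|]]].
- have N : (if e then cnext 3 i else if i == 0 then 2 else i.-1) != j.
    by case: e i i3 => -[|[|[|]]] // _; rewrite /cnext /=; lia.
  by rewrite (negPf N) orbF.
- have N : (if e then cnext 3 j else if j == 0 then 2 else j.-1) != i.
    by case: e j j3 => -[|[|[|]]] // _; rewrite /cnext /=; lia.
  by rewrite (negPf N) !orbF.
by rewrite orbC.
Qed.

Section Extremal.
Variables n d : nat.
Hypothesis d2 : 2 < d.
Local Notation a := (uphalf (d - 1)).
Local Notation b := ((d - 1)./2).

Let ab : [/\ a + b = d - 1, 0 < b & b <= a <= b.+1]. Proof. by split; lia. Qed.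

Lemma cparentP j : 2 < j ->
  (j = 3 \/ 3 + a + b <= j) /\ cparent d j = 0 \/ j = 3 + a /\ cparent d j = 1 \/
  (3 < j < 3 + a \/ 3 + a < j < 3 + a + b) /\ cparent d j = j.-1.
Proof. by rewrite /cparent; case: ab => ? ? ? ?; repeat case: ifP => ?; lia. Qed.

Hypothesis dn : d + 2 <= n.

Lemma cmap_lt e j : j < n -> cmap e d j < n.
Proof.
rewrite /cmap /cparent /cnext; case: ab => ? ? ?; case: e; repeat case: ifP => ?; lia.
Qed.

Definition cfun (x : 'I_n) : 'I_n := Ordinal (cmap_lt true (ltn_ord x)).
Definition cheight (x : 'I_n) :=
  if x < 3 then 0 else if x < 3 + a then x - 2
  else if x < 3 + a + b then x - (2 + a) else 1.
Definition cpos (x : 'I_n) : nat :=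
  if x < 3 then nat_of_ord x else if x < 3 + a then 0
  else if x < 3 + a + b then 1 else 0.
Let n0 : 0 < n. Proof. by lia. Qed.
Definition cord j : 'I_n := insubd (Ordinal n0) j.

Lemma cordE j : j < n -> cord j = j :> nat.
Proof. by move=> jn; rewrite val_insubd jn. Qed.

Lemma C3_map : unicyclic_map (C3graph n d) 3 cfun cheight cpos cord.
Proof.
case: (ab) => ab1 ab2 ab3; split=> //.
- by move=> u v; rewrite /C3graph (cadj_cmap true).
- by move=> u; rewrite /cpos; repeat case: ifP => ?; lia.
- move=> u; rewrite /cheight /cpos /= /cmap; case: (ltnP u 3) => // /cparentP.
  by move: (cparent d u) => y H; repeat case: ifP => ?; lia.
- move=> u; rewrite /cheight /cpos /= /cmap; case: (ltnP u 3) => u3; last first.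
    by repeat case: ifP => ?; lia.
  by move=> _; case: (val u) u3 => [|[|[|]]].
- move=> i i3; rewrite /cheight /cpos cordE ?i3 //; lia.
move=> u; rewrite /cheight /cpos; case: (ltnP u 3) => u3.
  by move=> _; apply: val_inj; rewrite /= cordE.
by repeat case: ifP => ?; lia.
Qed.

Lemma cfun_up (x : 'I_n) : 2 < cfun x ->
  x = (cfun x).+1 :> nat /\ (x < 3 + a \/ 3 + a < x < 3 + a + b).
Proof.
rewrite /= /cmap /cparent /cnext; case: ab => ? ? ?.
by case: (ltnP x 3) => ?; repeat case: ifP => ?; lia.
Qed.

(* The subtree above the vertex [w] lies in the interval from [w] to [cend w - 1]. *)
Definition cend (w : nat) :=
  if w < 3 + a then 3 + a else if w < 3 + a + b then 3 + a + b else w.+1.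

Lemma cfun_iter_up m (x : 'I_n) :
  2 < iter m cfun x -> iter m cfun x <= x < cend (iter m cfun x).
Proof.
elim: m x => [|m IH] x.
  by rewrite /= /cend => ?; repeat case: ifP => ?; lia.
rewrite iterSr => H; have := IH _ H; have [lt|ge] := ltnP 2 (cfun x); last by lia.
have [xE] := cfun_up lt; rewrite /cend; repeat case: ifP => ?; lia.
Qed.

Lemma card_interval i j : #|[set x : 'I_n | i <= x < j]| <= j - i.
Proof.
rewrite cardE -(size_map val) -(size_iota i (j - i)); apply: uniq_leq_size.
  by rewrite (map_inj_uniq val_inj) enum_uniq.
by move=> x /mapP[y]; rewrite mem_enum inE => H ->; rewrite mem_iota /=; lia.
Qed.

Lemma card_csubtree (w : 'I_n) : 2 < w -> #|subtree cfun cheight w| <= cend w - w.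
Proof.
move=> w3; apply: leq_trans (card_interval w (cend w)).
apply/subset_leq_card/subsetP => x; rewrite !inE => /andP[_ /eqP xw].
by have := @cfun_iter_up (cheight x - cheight w) x; rewrite xw; apply.
Qed.

Lemma cfun_down (x : 'I_n) i : (2 + i < x < 3 + a) || (2 + a + i < x < 3 + a + b) ->
  iter i cfun x = x - i :> nat.
Proof.
case: ab => ? ? ?; elim: i => [|i IH] H; first by rewrite subn0.
have xi : iter i cfun x = x - i :> nat by apply: IH; lia.
by rewrite iterS /= xi /cmap /cparent; repeat case: ifP => ?; lia.
Qed.

(** The far ends of the two pendent paths. *)
Definition cleaf0 := cord (2 + a).
Definition cleaf1 := cord (2 + a + b).

Let leaf0E : cleaf0 = 2 + a :> nat. Proof. by rewrite cordE //; lia. Qed.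
Let leaf1E : cleaf1 = 2 + a + b :> nat. Proof. by rewrite cordE //; lia. Qed.

Lemma C3_leaves :
  [/\ cheight cleaf0 = a, cheight cleaf1 = b, cpos cleaf0 = 0 & cpos cleaf1 = 1].
Proof.
case: ab => ? ? ?; rewrite /cheight /cpos leaf0E leaf1E.
by split; repeat case: ifP => ?; lia.
Qed.

Lemma C3_legs : legs 3 cfun cheight cpos cleaf0 cleaf1 a b 1.
Proof.
have [h0 h1 p0 p1] := C3_leaves.
split; rewrite ?h0 ?h1 ?p0 ?p1 //; first by lia.
move=> i j ia jb; apply: contraTneq isT => /(congr1 val) /=.
by rewrite !cfun_down ?leaf0E ?leaf1E; lia.
Qed.

Lemma C3_weight : weight cheight cpos 1 = b /\ weight cheight cpos 2 = 0.
Proof.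
have [h0 h1 p0 p1] := C3_leaves; case: (ab) => ? ? ?; split; last first.
  rewrite /weight big1 // => x; rewrite /cheight /cpos.
  by repeat case: ifP => ?; lia.
apply/eqP; rewrite eqn_leq; apply/andP; split.
  have := card_interval (3 + a) (3 + a + b); have -> : 3 + a + b - (3 + a) = b by lia.
  apply: leq_trans; rewrite -sum1_card [X in _ <= X]big_mkcond.
  rewrite /weight [X in X <= _]big_mkcond.
  apply: leq_sum => x _; rewrite inE /cheight /cpos.
  by case: (ltnP x 3) => ?; case: (ltnP x (3 + a)) => ?;
     case: (ltnP x (3 + a + b)) => ? //=; case: ifP => ?; lia.
have := leg_weight C3_map (u := cleaf1) (a := b); rewrite p1; apply; lia.
Qed.

Lemma path_term_half i : i < a -> path_term n d i = i * (n.-1 - i).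
Proof.
case: ab => ? ? ? ia; rewrite /path_term.
by have -> : minn i (d.-1 - i) = i by lia.
Qed.

(** Above a path vertex there is only the rest of its path, so its [leg_bound] is attained; a
    pendent vertex at [v1] outside the paths contributes [0]. *)
Lemma C3_tree_sum : tree_sum cfun cheight <=
  \sum_(i < a) path_term n d i + \sum_(i < b) path_term n d i.
Proof.
have dE : a + 1 + b = d by case: ab; lia.
have [h0 h1 p0 p1] := C3_leaves; case: (ab) => ? ? ?.
rewrite -(leg_bound_sum C3_map C3_legs dE); apply: leq_sum => w hw.
have w3 : 2 < w by move: hw; rewrite /cheight; case: ifP => ?; lia.
have cw := card_csubtree w3; rewrite /leg_bound h0 h1.
have [wa|wa] := ltnP w (3 + a).
  have wE : w = iter (2 + a - w) cfun cleaf0.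
    by apply: val_inj; rewrite /= cfun_down leaf0E; lia.
  have wL : w \in leg cfun cleaf0 a by rewrite wE mem_leg //; lia.
  have lt : 2 + a - w < #|subtree cfun cheight w|.
    have := @subtree_leg _ _ _ _ _ _ _ C3_map cleaf0 a (2 + a - w).
    by rewrite -wE h0; apply; lia.
  have cE : cend w = 3 + a by rewrite /cend wa.
  rewrite wL.
  have -> : a - cheight w = 2 + a - w by rewrite /cheight; repeat case: ifP => ?; lia.
  rewrite path_term_half; last by lia.
  apply: leq_trans (leq_addr _ _); apply: eq_leq.
  by congr (_ * _); lia.
have [wb|wb] := ltnP w (3 + a + b).
  have wE : w = iter (2 + a + b - w) cfun cleaf1.
    by apply: val_inj; rewrite /= cfun_down leaf1E; lia.
  have wL : w \in leg cfun cleaf1 b by rewrite wE mem_leg //; lia.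
  have lt : 2 + a + b - w < #|subtree cfun cheight w|.
    have := @subtree_leg _ _ _ _ _ _ _ C3_map cleaf1 b (2 + a + b - w).
    by rewrite -wE h1; apply; lia.
  have cE : cend w = 3 + a + b by rewrite /cend ltnNge wa wb.
  rewrite wL.
  have -> : b - cheight w = 2 + a + b - w.
    by rewrite /cheight; repeat case: ifP => ?; lia.
  rewrite path_term_half; last by lia.
  apply: leq_trans (leq_addl _ _); apply: eq_leq.
  by congr (_ * _); lia.
have cE : cend w = w.+1 by rewrite /cend; repeat case: ifP => ?; lia.
by have -> : #|subtree cfun cheight w|.-1 = 0 by lia.
Qed.

Lemma C3_Sz : Sz_e (C3graph n d) <= Sz_min n d.
Proof.
have [w1 w2] := C3_weight; have [ws cs] := cyc_sum3 C3_map (erefl 3).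
have dE : a + 1 + b = d by case: ab; lia.
case: (ab) => ? ? ?.
have := path_term_sum n a 1 b; rewrite /= dE big_ord1 addn0 => pS.
rewrite (um_Sz_E C3_map) /Sz_min pS.
have := C3_tree_sum; rewrite cs w1 w2.
(* The path edge of index [a] is the triangle edge, and [d.-1 - a = b <= a]. *)
have -> : path_term n d a = b * (n.-1 - b).
  by rewrite /path_term; have -> : minn a (d.-1 - a) = b by lia.
have -> : d.-1./2 = b by congr _./2; lia.
rewrite w1 w2 in ws.
have -> : b * (n.-1 - b) = weight cheight cpos 0 * b + 2 * b.
  by rewrite -mulnDl mulnC; congr (_ * _); lia.
have le : 2 * b <= 2 * n - 3 by lia.
rewrite muln0 mul0n !addn0 => H; rewrite -addnA [2 * n - 3 + _]addnC -addnA.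
move: H le; clear; move: (weight _ _ _ * b) (2 * b) (2 * n - 3) => X B Y.
move: (tree_sum _ _) (bigop.body _ _ _) (bigop.body _ _ _) => T S1 S2; lia.
Qed.

(** Upper bound: go through the cycle; heights are at most [a], [b] and [0] at positions [0], [1]
    and [2], and [2 * a <= d]. Lower bound: [phi] vanishes at [cleaf1], changes by at most one per
    edge, and equals [a + b + 1 = d] at [cleaf0]. *)
Lemma C3_diameter : diameter (C3graph n d) = d.
Proof.
have Gc := um_connected C3_map; have Gs := (um_simple C3_map).1.
have [h0 h1 p0 p1] := C3_leaves; case: (ab) => ? ? ?.
apply/eqP; rewrite eqn_leq; apply/andP; split.
  apply/bigmax_leqP => x _; apply/bigmax_leqP => y _.
  have px := um_p C3_map x; have py := um_p C3_map y.
  have := dist_triangle Gc (cord (cpos y)) x y.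
  rewrite (um_dist_cyc C3_map) // (dist_sym Gs Gc (cord (cpos y)) y).
  rewrite (um_dist_cyc C3_map) //.
  have c3 i j : i < 3 -> j < 3 -> cdist 3 i j = (i != j).
    by case: i => [|[|[|]]] //; case: j => [|[|[|]]].
  rewrite !c3 // eqxx addn0.
  have hb z : cheight z <= if cpos z == 0 then a else if cpos z == 1 then b else 0.
    rewrite /cheight /cpos; case: (ltnP z 3) => ?; case: (ltnP z (3 + a)) => ?;
    by case: (ltnP z (3 + a + b)) => ? //=; lia.
  have := hb x; have := hb y; have [-> |ne] := eqVneq (cpos x) (cpos y).
    by repeat case: ifP => ?; lia.
  by repeat case: ifP => ?; lia.
pose phi x := if cpos x == 1 then b - cheight x else b.+1 + cheight x.
have := @dist_ge _ _ Gc phi cleaf1 _ _ cleaf0.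
rewrite {1 4}/phi p0 p1 h0 h1 subnn /= => /(_ erefl) H.
apply: leq_trans (leq_bigmax cleaf0); apply: leq_trans (leq_bigmax cleaf1).
apply: leq_trans (H _); first by lia.
move=> x y; rewrite (um_adj C3_map).
suff key z : phi z <= (phi (cfun z)).+1 /\ phi (cfun z) <= (phi z).+1.
  by case/orP => /eqP <-; [case: (key x)|case: (key y)].
rewrite /phi; have [hz|hz] := posnP (cheight z).
  have [-> ->] := um_cyc C3_map hz; rewrite hz /cnext.
  have := um_p C3_map z; by repeat case: ifP => ?; lia.
have [hz' ->] := um_tree C3_map hz; by case: ifP => ?; lia.
Qed.

End Extremal.

(** Adjacency is determined by [f] in one graph and by [cmap] in the other, so a vertex list on
    whose indices [f] acts as [cmap e d] makes [index] an isomorphism. *)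
Lemma C3_iso n d e (G : rel 'I_n) (f : 'I_n -> 'I_n) (s : seq 'I_n) :
  (forall u v, G u v = (f u == v) || (f v == u)) ->
  uniq s -> (forall w, w \in s) ->
  (forall x0 j, j < n -> f (nth x0 s j) = nth x0 s (cmap e d j)) ->
  (forall j, j < n -> cmap e d j < n) ->
  isomorphic G (C3graph n d).
Proof.
move=> adj us sall fs cl.
have sn : size s = n.
  by rewrite -(card_uniqP us) -[RHS]card_ord; apply: eq_card => w; rewrite sall.
have lt w : index w s < n by have := sall w; rewrite -index_mem sn.
pose F w := Ordinal (lt w).
have idx w : index (f w) s = cmap e d (index w s).
  by rewrite -{1}(nth_index w (sall w)) (fs w _ (lt w)) index_uniq // sn cl.
have inj : injective (fun w => index w s).
  by move=> x y E; rewrite -(nth_index x (sall x)) E nth_index.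
exists F; split; first by apply: injF_bij => x y [] /inj.
move=> x y; rewrite /C3graph (cadj_cmap e) adj /= -!idx.
by rewrite (inj_eq inj) (inj_eq inj).
Qed.

(** * Reconstruction of the graph in the equality case *)

Section Equality.
Variables (n : nat) (G : rel 'I_n) (f : 'I_n -> 'I_n).
Variables (h p : 'I_n -> nat) (c : nat -> 'I_n).
Hypothesis M : unicyclic_map G 3 f h p c.
Variables (s0 s1 : nat) (u0 u1 : 'I_n) (d : nat).
Hypotheses (d2 : 2 < d) (dn : d + 2 <= n).
Local Notation a := (uphalf (d - 1)).
Local Notation b := ((d - 1)./2).
Hypotheses (s01 : s0 = 0 /\ s1 = 1 \/ s0 = 1 /\ s1 = 0).
Hypotheses (hu0 : h u0 = a) (hu1 : h u1 = b) (pu0 : p u0 = s0) (pu1 : p u1 = s1).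
Hypotheses (w1 : weight h p s1 = b) (w2 : weight h p 2 = 0).
Hypothesis sub0 : forall i, i < a -> #|subtree f h (iter i f u0)| = i.+1.
Hypothesis sub_other : forall w, 0 < h w ->
  w \notin leg f u0 a -> w \notin leg f u1 b ->
  #|subtree f h w| = 1.

Let au : a <= h u0. Proof. by rewrite hu0. Qed.
Let bu : b <= h u1. Proof. by rewrite hu1. Qed.

(** The leg already accounts for the whole weight [b] at position [s1]. *)
Lemma weight_full : forall w, 0 < h w -> p w = s1 -> w \in leg f u1 b.
Proof.
move=> w hw pw; apply: contraT => wN.
have : b < weight h p s1.
  rewrite -[X in X < _](card_leg M bu) -sum1_card /weight -big_mkcondr /=.
  rewrite [X in X < _]big_mkcond [X in _ < X]big_mkcond /=.
  rewrite (bigD1 w) //= [X in _ < X](bigD1 w) //= (negPf wN) hw pw eqxx ltnS.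
  apply: leq_sum => x _.
  by case: ifP => // /(leg_mem M bu)[-> -> _ _]; rewrite pu1 eqxx.
by rewrite w1 ltnn.
Qed.

Lemma pos_tree w : 0 < h w -> p w = s0 \/ p w = s1.
Proof.
move=> hw; have := um_p M w; suff : p w != 2 by lia.
apply/eqP => pw; have : 0 < weight h p 2.
  by rewrite /weight (bigD1 w) //= pw eqxx.
by rewrite w2.
Qed.

(** If [f w] were off the cycle, its subtree would contain [w] and have at least two vertices, so
    [f w] would lie on a leg, by position that of [u0]. But there the [i.+1] subtree vertices are
    all leg vertices, and [w] is not one. *)
Lemma parent_other w :
  0 < h w -> w \notin leg f u0 a -> w \notin leg f u1 b -> f w = c s0.
Proof.
move=> hw w0N w1N; have pw : p w = s0.
  by case: (pos_tree hw) => // /(weight_full hw); rewrite (negPf w1N).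
have [hf pf] := um_tree M hw; have [hf0|hfp] := posnP (h (f w)).
  by have := um_root M w; rewrite -hf hf0 /= pw.
have wS : w \in subtree f h (f w) by rewrite inE -hf leqnSn subSnn /= eqxx.
have fS := subtree_self f h (f w).
have card2 : 1 < #|subtree f h (f w)|.
  by rewrite (cardsD1 w) wS (cardsD1 (f w)) in_setD1 (um_f_neq M) fS.
have [/(leg_mem M au)[_ _ lt fE]|f0] := boolP (f w \in leg f u0 a); last first.
  have [/(leg_mem M bu)[_ pf1 _ _]|f1] := boolP (f w \in leg f u1 b).
    by move: s01 pf1; rewrite pf pw pu1; lia.
  by rewrite (sub_other hfp f0 f1) in card2.
set i := h u0 - h (f w) in lt fE; have := sub0 lt; rewrite -fE.
have lt' : i.+1 <= h u0 by rewrite hu0.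
rewrite (cardsD1 w) wS => E.
suff : i.+1 <= #|subtree f h (f w) :\ w| by lia.
rewrite -(card_leg M lt'); apply/subset_leq_card/subsetP => x /legP[j ji ->].
rewrite !inE; apply/andP; split.
  by apply: contraNneq w0N => <-; apply: mem_leg; lia.
rewrite fE !(um_h_iter M); apply/andP; split; first by lia.
by rewrite -iterD; apply/eqP; congr iter; lia.
Qed.

(** The order follows the numbering of the extremal graph. Legs are reversed: they are listed from
    the free end, while the numbering runs outwards from the triangle. *)
Let base := [:: c s0; c s1; c 2] ++ [seq iter (a.-1 - i) f u0 | i <- iota 0 a]
                               ++ [seq iter (b.-1 - i) f u1 | i <- iota 0 b].
Let verts := base ++ [seq w <- enum 'I_n | w \notin base].

Let ss : [/\ s0 < 3, s1 < 3, s0 != s1, s0 != 2 & s1 != 2].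
Proof. by split; lia. Qed.

Let cdata i : i < 3 -> h (c i) = 0 /\ p (c i) = i := @um_c _ _ _ _ _ _ _ M i.

Lemma mem_leg0 w :
  (w \in [seq iter (a.-1 - i) f u0 | i <- iota 0 a]) = (w \in leg f u0 a).
Proof.
apply/idP/idP => [/mapP[i]|/legP[i ia ->]].
  by rewrite mem_iota => ? ->; apply: mem_leg; lia.
by apply/mapP; exists (a.-1 - i); [rewrite mem_iota; lia|congr iter; lia].
Qed.

Lemma mem_leg1 w :
  (w \in [seq iter (b.-1 - i) f u1 | i <- iota 0 b]) = (w \in leg f u1 b).
Proof.
apply/idP/idP => [/mapP[i]|/legP[i ia ->]].
  by rewrite mem_iota => ? ->; apply: mem_leg; lia.
by apply/mapP; exists (b.-1 - i); [rewrite mem_iota; lia|congr iter; lia].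
Qed.

Lemma base_uniq : uniq base.
Proof.
case: ss => s03 s13 n01 n02 n12.
have cneq i j : i < 3 -> j < 3 -> i != j -> (c i == c j) = false.
  move=> i3 j3 ij; apply: contraNF ij => /eqP E.
  by rewrite -(cdata i3).2 -(cdata j3).2 E.
have ctree i w : i < 3 -> 0 < h w -> (w == c i) = false.
  by move=> i3 hw; apply: contraTF hw => /eqP ->; rewrite (cdata i3).1.
rewrite /base !cat_uniq has_cat negb_or; apply/and5P; split.
- by rewrite /= !inE !cneq.
- apply/andP; split; apply/hasPn => w; rewrite ?mem_leg0 ?mem_leg1 !inE.
    by move=> /(leg_mem M au)[hw _ _ _]; rewrite !ctree.
  by move=> /(leg_mem M bu)[hw _ _ _]; rewrite !ctree.
- rewrite map_inj_in_uniq ?iota_uniq // => i j; rewrite !mem_iota => ? ? /(congr1 h).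
  by rewrite !(um_h_iter M) hu0; lia.
- apply/hasPn => w; rewrite mem_leg1 mem_leg0 => /(leg_mem M bu)[_ pw _ _].
  by apply/negP => /(leg_mem M au)[_ pw' _ _]; lia.
rewrite map_inj_in_uniq ?iota_uniq // => i j; rewrite !mem_iota => ? ? /(congr1 h).
by rewrite !(um_h_iter M) hu1; lia.
Qed.

Lemma verts_uniq : uniq verts.
Proof.
rewrite cat_uniq base_uniq filter_uniq ?enum_uniq // andbT /=.
by apply/hasPn => w; rewrite mem_filter => /andP[].
Qed.

Lemma mem_verts w : w \in verts.
Proof. by rewrite mem_cat mem_filter mem_enum andbT orbN. Qed.

Lemma size_base : size base = 3 + a + b.
Proof. by rewrite !size_cat !size_map !size_iota /=; lia. Qed.

Lemma size_verts : size verts = n.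
Proof.
rewrite -(card_uniqP verts_uniq) -[RHS]card_ord.
by apply: eq_card => w; rewrite mem_verts.
Qed.

Lemma nth_verts0 x0 j : 2 < j < 3 + a -> nth x0 verts j = iter (2 + a - j) f u0.
Proof.
move=> ja; rewrite nth_cat size_base; case: ltnP; last by lia.
move=> _; rewrite nth_cat /=; case: ltnP; first by lia.
move=> _; rewrite nth_cat size_map size_iota; case: ltnP; last by lia.
move=> ?; rewrite (nth_map 0) ?size_iota ?nth_iota //; by congr iter; lia.
Qed.

Lemma nth_verts1 x0 j : 3 + a <= j < 3 + a + b ->
  nth x0 verts j = iter (2 + a + b - j) f u1.
Proof.
move=> ja; rewrite nth_cat size_base; case: ltnP; last by lia.
move=> _; rewrite nth_cat /=; case: ltnP; first by lia.
move=> _; rewrite nth_cat size_map size_iota; case: ltnP; first by lia.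
move=> ?; rewrite (nth_map 0) ?size_iota ?nth_iota; try lia; by congr iter; lia.
Qed.

Lemma nth_verts2 x0 j : 3 + a + b <= j < n -> f (nth x0 verts j) = c s0.
Proof.
move=> ja; rewrite nth_cat size_base; case: ltnP; first by lia.
move=> lej; set w := nth _ _ _.
have : w \in [seq w <- enum 'I_n | w \notin base].
  apply: mem_nth; have := size_verts; rewrite /verts size_cat size_base => E.
  by rewrite ltn_subLR ?E; lia.
rewrite mem_filter mem_enum andbT /base !mem_cat mem_leg0 mem_leg1 !negb_or.
case/and3P => wc w0N w1N; apply: parent_other => //.
rewrite lt0n; apply/eqP => hw; move: wc; rewrite -(um_pK M hw).
have [->|[->|->]] : p w = s0 \/ p w = s1 \/ p w = 2 by have := um_p M w; lia.
all: by rewrite eqxx ?andbF.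
Qed.

Lemma Sz_eq_iso : isomorphic G (C3graph n d).
Proof.
(* In the order [c s0], [c s1], [c 2], the map [f] traverses the triangle forwards if [s0 = 0] and
   backwards if [s0 = 1]. *)
have [s03 s13 n01 n02 n12] := ss; pose e := s0 == 0.
apply: (@C3_iso n d e G f verts (um_adj M) verts_uniq mem_verts); last first.
  by move=> j; apply: cmap_lt.
move=> x0 j jn; have b0 : 0 < b by lia.
have v0 : nth x0 verts 0 = c s0 by [].
have v1 : nth x0 verts 1 = c s1 by [].
have v2 : nth x0 verts 2 = c 2 by [].
rewrite /cmap; have [j3|j3] := ltnP j 3.
  have fc := um_f_cyc M; rewrite /e.
  case: s01 => -[E0 E1]; rewrite E0 E1 in v0 v1 *;
  by case: j j3 {jn} => [|[|[|]]] // _; rewrite ?v0 ?v1 ?v2 fc.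
have root u : iter (h u) f u = c (p u) := um_root M u.
have := cparentP d2 j3; have [ja|ja] := ltnP j (3 + a).
  rewrite nth_verts0 -?iterS; last by lia.
  have [je|jne] := eqVneq j 3.
    rewrite je => cp; have -> : cparent d 3 = 0 by lia.
    by rewrite v0 -pu0 -root hu0; congr (iter _ f _); lia.
  move=> cp; have -> : cparent d j = j.-1 by lia.
  by rewrite nth_verts0; [congr (iter _ f _)|]; lia.
have [jb|jb] := ltnP j (3 + a + b).
  rewrite nth_verts1 -?iterS; last by lia.
  have [je|jne] := eqVneq j (3 + a).
    move=> cp; have -> : cparent d j = 1 by lia.
    by rewrite v1 -pu1 -root hu1; congr (iter _ f _); lia.
  move=> cp; have -> : cparent d j = j.-1 by lia.
  by rewrite nth_verts1; [congr (iter _ f _)|]; lia.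
by move=> cp; have -> : cparent d j = 0; [lia|rewrite v0 nth_verts2 //; lia].
Qed.

End Equality.

Lemma legs_rebase n (G : rel 'I_n) k f h p c u v a b t :
  @unicyclic_map n G k f h p c -> legs k f h p u v a b t ->
  legs k f h (fun w => fwd k (p u) (p w)) u v a b t.
Proof.
move=> M [au bv tE tk off top dj]; split=> //.
by rewrite tE {2}/fwd leqnn subnn /fwd leq0n subn0.
Qed.

(** By [mul_eq_min] one side of the bridge has exactly [i] edges. It is the subtree side, since the
    other has at least [d + 1 - i > i]. *)
Lemma subtree_leg_tight n (G : rel 'I_n) f h p c u v a b d i :
  @unicyclic_map n G 3 f h p c -> a <= h u -> b <= h v -> h u - a = h v - b ->
  (forall i j, i < a -> j < b -> iter i f u != iter j f v) ->
  a + 1 + b = d -> i < a -> i + i < d ->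
  #|subtree f h (iter i f u)|.-1 * (n - #|subtree f h (iter i f u)|) = path_term n d i ->
  #|subtree f h (iter i f u)| = i.+1.
Proof.
move=> M au bv off dj abd ia id; have lo := subtree_leg M ia au.
have hi := subtree_leg_out M au bv off dj ia; set s := #|_| in lo hi *.
rewrite /path_term; have -> : minn i (d.-1 - i) = i by lia.
have -> : n.-1 - i = s.-1 + (n - s) - i by lia.
by move=> E; have := @mul_eq_min i s.-1 (n - s) _ _ E; lia.
Qed.

Lemma Sz_e_equality n (G : rel 'I_n) f h p c u v a b d :
  unicyclic_map G 3 f h p c -> legs 3 f h p u v a b 1 -> p u = 0 ->
  2 < d -> a + 1 + b = d -> d + 2 <= n ->
  minn a b = (a + b)./2 -> weight h p 2 = 0 ->
  weight h p 0 = minn a b \/ weight h p 1 = minn a b ->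
  (forall w, 0 < h w ->
     #|subtree f h w|.-1 * (n - #|subtree f h w|) = leg_bound f h u v a b d w) ->
  isomorphic G (C3graph n d).
Proof.
move=> M L pu d2 abd dn mE w2 w01 tight; case: (L) => au bv _ _ off /(_ isT) hu dj.
have hv : h v = b by lia.
have pv := legs_pv L pu; have [wa wb] := legs_le_weight M L pu.
have dj' i j : i < b -> j < a -> iter i f v != iter j f u.
  by move=> ib ja; rewrite eq_sym dj.
have inu i : i < a -> leg_bound f h u v a b d (iter i f u) = path_term n d i.
  move=> ia; rewrite /leg_bound mem_leg // (um_h_iter M) subKn; last by lia.
  rewrite [_ \in leg f v b](_ : _ = false) ?addn0 //.
  by apply/negP => /legP[j jb]; apply/eqP/dj.
have inv i : i < b -> leg_bound f h u v a b d (iter i f v) = path_term n d i.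
  move=> ib; rewrite /leg_bound mem_leg // (um_h_iter M) subKn; last by lia.
  rewrite [_ \in leg f u a](_ : _ = false) ?add0n //.
  by apply/negP => /legP[j jb]; apply/eqP/dj'.
have subu i : i < a -> i + i < d -> #|subtree f h (iter i f u)| = i.+1.
  move=> ia id; apply: (subtree_leg_tight M au bv off dj abd ia id).
  by rewrite -inu // tight // (um_h_iter M); lia.
have subv i : i < b -> i + i < d -> #|subtree f h (iter i f v)| = i.+1.
  move=> ib id; have bad : b + 1 + a = d by lia.
  apply: (subtree_leg_tight M bv au (esym off) dj' bad ib id).
  by rewrite -inv // tight // (um_h_iter M); lia.
have other w : 0 < h w -> w \notin leg f u a -> w \notin leg f v b ->
    #|subtree f h w| = 1.
  move=> hw wu wv; have := tight w hw; rewrite /leg_bound (negPf wu) (negPf wv).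
  have := subtree_cyc M hw; have := subtree_lt f h w => s0 sn /eqP.
  by rewrite muln_eq0; lia.
(* The position of weight [minn a b] carries nothing but its leg, which is a shorter one; it plays
   the part of [s1]. *)
case: w01 => w.
  have bE : b = uphalf (d - 1) by lia.
  have aE : a = (d - 1)./2 by lia.
  apply: (@Sz_eq_iso n G f h p c M 1 0 v u d) => //; rewrite -?aE -?bE //; try lia.
    by move=> i ib; apply: subv => //; lia.
  by move=> x hx xv xu; apply: other.
have aE : a = uphalf (d - 1) by lia.
have bE : b = (d - 1)./2 by lia.
apply: (@Sz_eq_iso n G f h p c M 0 1 u v d) => //; rewrite -?aE -?bE //; try lia.
by move=> i ib; apply: subu => //; lia.
Qed.

Theorem theorem1p1 (n d : nat) :
  (6 <= n)%N -> (3 <= d)%N -> (d <= n - 2)%N ->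
  [/\ simple_graph (C3graph n d), unicyclic (C3graph n d),
      diameter (C3graph n d) = d &
      forall G : rel 'I_n, simple_graph G -> unicyclic G -> diameter G = d ->
        (Sz_e (C3graph n d) <= Sz_e G)%N /\
        (Sz_e G = Sz_e (C3graph n d) -> isomorphic G (C3graph n d))].
Proof.
move=> n6 d3 dn2; have dn : d + 2 <= n by lia.
have MC := C3_map d3 dn; have SC := C3_Sz d3 dn.
split; [exact: um_simple MC| |exact: C3_diameter|].
  by split; [exact: um_connected MC|exact: um_card_edges MC].
move=> G sG uG dG; have n0 : 0 < n by lia.
have [k [f [h [p0 [c0 M0]]]]] := unicyclic_mapP sG uG n0.
have [u [v [a [b [t [L0]]]]]] := legs_diameter M0; rewrite dG => abd.
(* The cycle is renumbered from [p u], so that the first leg sits at position [0]. *)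
have M := um_rebase M0 (um_p M0 u); have L := legs_rebase M0 L0.
set p := (fun _ => _) in M L; have pu : p u = 0 by rewrite /p /fwd leqnn subnn.
have d3' : 2 < a + t + b by rewrite abd.
have [] := Sz_ge M L pu n6 d3'; rewrite abd => lo eq.
split; first by apply: leq_trans lo.
move=> E; have [[k3 t1] mE w2 w01 tight] := eq ltac:(lia).
rewrite {}k3 {}t1 in M L abd; apply: (Sz_e_equality M L) => //.
Qed.
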